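(* There exists a birational equivalence, defined over $\mathbb Q$, between $S_1(6)\times_{X_1(6)}S_1(6)$ and $Y$, where $S_1(6)\to X_1(6)$ is the universal elliptic curve over the modular curve $X_1(6)$ and $Y$ is the Barth-Nieto Calabi-Yau model of the quintic $N=\{\sum_{i=0}^5x_i=\sum_{i=0}^5\frac1{x_i}=0\}\subset\mathbb P_5$.
   Context: By Beauville, the universal elliptic curve $S_1(6)\to X_1(6)\cong\mathbb P_1$ for $\Gamma_1(6)$ is given by the pencil of plane cubics $(X+Y)(Y+Z)(Z+X)+tXYZ=0$, with $t$ the coordinate on $\mathbb P_1$; thus $S_1(6)\times_{X_1(6)}S_1(6)$ is, up to birational equivalence over $\mathbb Q$, the fibre square over the $t$-line of this pencil, inside $\mathbb P_2\times\mathbb P_1\times\mathbb P_2$. The Barth-Nieto quintic $N$ is the hypersurface in $\mathbb P^{(0)}=\{x\in\mathbb P_5:\sum x_i=0\}\cong\mathbb P_4$ given by $\sigma_5(x)=\sum_{j=0}^5\prod_{i\ne j}x_i=0$. Let $N^{(3)}$ be the strict transform of $N$ under successively blowing up $\mathbb P^{(0)}$ in the 15 points where four coordinates vanish, then along the strict transforms of the 20 lines $\{x_k=x_\ell=x_m=0\}$, then along the strict transforms of the 15 planes $\{x_k=x_\ell=0\}$. The singularities of $N^{(3)}$ are 10 ordinary double points at $(1:1:1:-1:-1:-1)$ and its coordinate permutations (the Segre points), and $Y\to N^{(3)}$ is the Barth-Nieto small resolution replacing each of these points by a line $\mathbb P_1$. The variety $Y$ is a smooth Calabi-Yau threefold,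 defined over $\mathbb Q$ and birational to $N$ over $\mathbb Q$. *)

(* Defs.v *)
From HB Require Import structures.
From mathcomp Require Import all_boot all_order all_algebra all_field.
From mathcomp Require Import mpoly.

Set Implicit Arguments.
Unset Strict Implicit.
Unset Printing Implicit Defensive.

Import GRing.Theory.
Local Open Scope ring_scope.

(* Varieties over Q, in the classical language: a variety is a set of
   geometric points (coordinates in algC, the algebraic closure of Q) of a
   product of projective spaces, cut out by multihomogeneous polynomials with
   rational coefficients.  Closed sets, ideals and morphisms are all taken
   over Q. *)

(* A product of projective spaces is given by its total list of homogeneous
   coordinates and by the factor to which each coordinate belongs. *)
Record multiproj := MultiProj {
  ncoord : nat;
  nfactor : nat;
  factor_of : 'I_ncoord -> 'I_nfactor
}.

Definition projsp (n : nat) : multiproj :=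
  @MultiProj n.+1 1 (fun _ => ord0).

Definition prodsp (P Q : multiproj) : multiproj :=
  @MultiProj (ncoord P + ncoord Q) (nfactor P + nfactor Q)
    (fun i => match split i with
              | inl j => lshift (nfactor Q) (factor_of j)
              | inr k => rshift (nfactor P) (factor_of k)
              end).

(* Points are handled through vectors of homogeneous coordinates:
   [is_point x] says that x represents a point, and [same_point x y] that x
   and y represent the same one. *)
Definition vec (P : multiproj) : Type := 'I_(ncoord P) -> algC.

Definition is_point (P : multiproj) (x : vec P) : Prop :=
  forall j : 'I_(nfactor P), exists2 i, factor_of i = j & x i != 0.

Definition same_point (P : multiproj) (x y : vec P) : Prop :=
  exists2 l : 'I_(nfactor P) -> algC,
    forall j, l j != 0 & forall i, y i = l (factor_of i) * x i.

Definition fstv (P Q : multiproj) (z : vec (prodsp P Q)) : vec P :=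
  fun i => z (lshift (ncoord Q) i).

Definition sndv (P Q : multiproj) (z : vec (prodsp P Q)) : vec Q :=
  fun i => z (rshift (ncoord P) i).

Definition pset (P : multiproj) : Type := vec P -> Prop.

Definition allpoints (P : multiproj) : pset P := fun x => is_point x.

Definition evalQ (n : nat) (p : {mpoly rat[n]}) (x : 'I_n -> algC) : algC :=
  (map_mpoly (@ratr algC) p).@[x].

Definition multihomog (P : multiproj) (p : {mpoly rat[ncoord P]})
    (d : 'I_(nfactor P) -> nat) : Prop :=
  forall m, m \in msupp p ->
    forall j, (\sum_(i | factor_of i == j) m i)%N = d j.

Definition vanishes_on (P : multiproj) (p : {mpoly rat[ncoord P]})
    (A : pset P) : Prop :=
  forall x, A x -> evalQ p x = 0.

Definition closure (P : multiproj) (A : pset P) : pset P := fun x =>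
  is_point x /\
  forall (p : {mpoly rat[ncoord P]}) (d : 'I_(nfactor P) -> nat),
    multihomog p d -> vanishes_on p A -> evalQ p x = 0.

Definition closed (P : multiproj) (A : pset P) : Prop :=
  forall x, A x <-> closure A x.

Definition open_in (P : multiproj) (U X : pset P) : Prop :=
  exists2 C : pset P, closed C & forall x, U x <-> X x /\ ~ C x.

Definition dense_in (P : multiproj) (U X : pset P) : Prop :=
  forall x, X x -> closure U x.

Definition irreducible (P : multiproj) (X : pset P) : Prop :=
  (exists x, X x) /\
  forall C D : pset P, closed C -> closed D ->
    (forall x, X x -> C x \/ D x) ->
    (forall x, X x -> C x) \/ (forall x, X x -> D x).

(* Morphisms defined over Q between locally closed sets: around every point
   they are given by multihomogeneous polynomials with rational coefficients
   (of the same multidegree for coordinates of the same factor). *)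
Definition regular_map (P Q : multiproj) (A : pset P) (B : pset Q)
    (phi : vec P -> vec Q) : Prop :=
  (forall x, A x -> B (phi x)) /\
  forall x, A x ->
    exists (f : 'I_(ncoord Q) -> {mpoly rat[ncoord P]})
           (e : 'I_(nfactor Q) -> 'I_(nfactor P) -> nat),
    [/\ forall i, multihomog (f i) (e (factor_of i)),
        @is_point Q (fun i => evalQ (f i) x)
      & forall y, A y -> @is_point Q (fun i => evalQ (f i) y) ->
          @same_point Q (phi y) (fun i => evalQ (f i) y)].

Definition mutually_inverse (P Q : multiproj) (A : pset P) (B : pset Q)
    (phi : vec P -> vec Q) (psi : vec Q -> vec P) : Prop :=
  [/\ regular_map A B phi, regular_map B A psi,
      forall x, A x -> same_point x (psi (phi x))
    & forall y, B y -> same_point y (phi (psi y))].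

Definition isomorphic (P Q : multiproj) (A : pset P) (B : pset Q) : Prop :=
  exists phi psi, mutually_inverse A B phi psi.

Definition birational (P Q : multiproj) (X : pset P) (Y : pset Q) : Prop :=
  exists (U : pset P) (V : pset Q),
    [/\ open_in U X, dense_in U X, open_in V Y, dense_in V Y
      & isomorphic U V].

(* The Zariski tangent space at x of the multicone over X; the multicone has
   dimension [dim X + nfactor P]. *)
Definition tangent (P : multiproj) (X : pset P) (x v : vec P) : Prop :=
  forall p : {mpoly rat[ncoord P]}, vanishes_on p X ->
    \sum_(i < ncoord P) evalQ p^`M(i) x * v i = 0.

Definition smooth_of_dim (P : multiproj) (d : nat) (X : pset P) : Prop :=
  forall x, X x ->
    exists2 T : 'M[algC]_(ncoord P), \rank T = (d + nfactor P)%N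
      & forall v : 'rV[algC]_(ncoord P),
          (v <= T)%MS <-> tangent X x (fun i => v ord0 i).

(* Polynomials of one common multidegree generating the ideal of the center Z
   in the coordinate ring of X, up to saturation; that is, generating the
   ideal sheaf of Z (with its reduced structure) in X.  In [ce_gen] the
   coordinates [c j], one for each factor, define a standard affine chart. *)
Record center_equations (P : multiproj) (X Z : pset P) := CenterEquations {
  ce_size : nat;
  ce_poly : 'I_ce_size.+1 -> {mpoly rat[ncoord P]};
  ce_deg : 'I_(nfactor P) -> nat;
  ce_homog : forall k, multihomog (ce_poly k) ce_deg;
  ce_vanish : forall k, vanishes_on (ce_poly k) Z;
  ce_gen : forall g : {mpoly rat[ncoord P]}, vanishes_on g Z ->
    forall c : 'I_(nfactor P) -> 'I_(ncoord P),
    (forall j, factor_of (c j) = j) ->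
    exists (N : nat) (q : 'I_ce_size.+1 -> {mpoly rat[ncoord P]})
           (h : {mpoly rat[ncoord P]}),
      vanishes_on h X /\
      (\prod_j 'X_(c j)) ^+ N * g = \sum_k q k * ce_poly k + h
}.

(* The blow-up of X in Z is the closure of the graph of the rational map from
   X to a projective space defined by such equations of Z; it is independent
   of their choice up to isomorphism over X.  Its blow-down map is [fstv]. *)
Definition blowup_space (P : multiproj) (X Z : pset P)
    (E : center_equations X Z) : multiproj :=
  prodsp P (projsp (ce_size E)).

Definition blowup (P : multiproj) (X Z : pset P)
    (E : center_equations X Z) : pset (blowup_space E) :=
  closure (fun z : vec (prodsp P (projsp (ce_size E))) =>
    [/\ X (fstv z), ~ Z (fstv z)
      & @same_point (projsp (ce_size E))
          (fun k => evalQ (@ce_poly _ _ _ E k) (fstv z)) (sndv z)]).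

Definition strict_transform (P : multiproj) (X Z : pset P)
    (E : center_equations X Z) (W : pset P) : pset (blowup_space E) :=
  closure (fun z : vec (prodsp P (projsp (ce_size E))) =>
    [/\ @blowup P X Z E z, W (fstv z) & ~ Z (fstv z)]).

(* The hyperplane sum x_i = 0 of P_5, and the union of the linear subspaces of
   it where k coordinates vanish: the 15 points, 20 lines and 15 planes for
   k = 4, 3 and 2. *)
Definition P0 : pset (projsp 5) := fun x =>
  is_point x /\ \sum_(i < 6) x i = 0.

Definition coord_strata (k : nat) : pset (projsp 5) := fun x =>
  P0 x /\ exists2 S : {set 'I_6}, #|S| = k & forall i, i \in S -> x i = 0.

Definition barth_nieto_quintic : pset (projsp 5) := fun x =>
  P0 x /\ \sum_(j < 6) \prod_(i < 6 | i != j) x i = 0.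

Definition segre_point (x : vec (projsp 5)) : Prop :=
  exists2 S : {set 'I_6}, #|S| = 3%N
    & @same_point (projsp 5) (fun i => if i \in S then 1 else -1) x.

(* The three successive blow-ups of P^(0).  At each stage the linear subspaces
   to be blown up have disjoint strict transforms, so that blowing up their
   union amounts to blowing them up one after the other. *)
Record barth_nieto_tower := BarthNietoTower {
  bnt1 : center_equations P0 (coord_strata 4);
  bnt2 : center_equations (blowup (E := bnt1))
           (strict_transform (E := bnt1) (coord_strata 3));
  bnt3 : center_equations (blowup (E := bnt2))
           (strict_transform (E := bnt2)
             (strict_transform (E := bnt1) (coord_strata 2)))
}.

Definition N3_space (T : barth_nieto_tower) : multiproj :=
  blowup_space (bnt3 T).

Definition N3 (T : barth_nieto_tower) : pset (N3_space T) :=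
  strict_transform (E := bnt3 T)
    (strict_transform (E := bnt2 T)
      (strict_transform (E := bnt1 T) barth_nieto_quintic)).

Definition N3_segre (T : barth_nieto_tower) : pset (N3_space T) := fun z =>
  N3 z /\
  segre_point (fstv (P := projsp 5)
    (fstv (P := blowup_space (bnt1 T)) (fstv (P := blowup_space (bnt2 T)) z))).

(* A projective small resolution, over Q, of the threefold X at the finite set
   of points S, replacing each point of S by a line. *)
Definition small_resolution (P Q : multiproj) (Y : pset P) (X S : pset Q)
    (pi : vec P -> vec Q) : Prop :=
  [/\ closed Y /\ irreducible Y,
      smooth_of_dim 3 Y,
      regular_map Y X pi,
      exists psi, mutually_inverse (fun y => Y y /\ ~ S (pi y))
                    (fun x => X x /\ ~ S x) pi psi
    & forall s, S s ->
        isomorphic (fun y => Y y /\ same_point s (pi y))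
                   (@allpoints (projsp 1))].

Definition barth_nieto_model (P : multiproj) (Y : pset P) : Prop :=
  exists (T : barth_nieto_tower) (pi : vec P -> vec (N3_space T)),
    small_resolution Y (@N3 T) (@N3_segre T) pi.

(* S_1(6) -> X_1(6) = P_1, as Beauville's pencil
   (X + Y)(Y + Z)(Z + X) + t XYZ = 0, where t = t_0 / t_1. *)
Definition beauville_pencil : pset (prodsp (projsp 2) (projsp 1)) := fun z =>
  let X := fstv z (inord 0) in
  let Y := fstv z (inord 1) in
  let Z := fstv z (inord 2) in
  let t0 := sndv z (inord 0) in
  let t1 := sndv z (inord 1) in
  is_point z /\ t1 * ((X + Y) * (Y + Z) * (Z + X)) + t0 * (X * Y * Z) = 0.

Definition pairv (P Q : multiproj) (x : vec P) (y : vec Q) :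
    vec (prodsp P Q) :=
  fun i => match split i with inl j => x j | inr k => y k end.

(* For a family X in P x B over B, its fibre square over B inside P x B x P. *)
Definition fibre_square (P B : multiproj) (X : pset (prodsp P B)) :
    pset (prodsp (prodsp P B) P) :=
  fun z => X (fstv z) /\ X (pairv (sndv z) (sndv (fstv z))).

Definition S16_fibre_square :
    pset (prodsp (prodsp (projsp 2) (projsp 1)) (projsp 2)) :=
  fibre_square beauville_pencil.

(* Main.v *)
From HB Require Import structures.
From mathcomp Require Import all_boot all_order all_algebra all_field.
From mathcomp Require Import mpoly ring.
From Stdlib Require Import Classical_Prop FunctionalExtensionality.
Require Import Defs.

(** Put lin = X + Y + Z, quad = XY + YZ + ZX and prod3 = XYZ.  Since
    (X + Y)(Y + Z)(Z + X) = lin quad - prod3, Beauville's pencil is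
    lin quad / prod3 = 1 - t, that is
    (X + Y + Z)(1/X + 1/Y + 1/Z) = 1 - t.  A point of the quintic N whose
    coordinates do not vanish is a pair of triples p = (x_0, x_1, x_2) and
    q = (x_3, x_4, x_5) with opposite sums and opposite sums of inverses, hence
    p and q lie on the same member of the pencil.  Conversely, two points p, q
    of one member with t <> 1 can be rescaled to have opposite sums, and then
    have opposite sums of inverses.  So (p, t, q) |-> (p lin(q), - q lin(p)) is
    an isomorphism from the open part of the fibre square where t is not
    0, infinity, -8 or 1 and where p and q are not base points, onto an open
    part of N ([square_quintic_isomorphic]).

    No coordinate vanishes on this open part of N, so it is disjoint from all
    the centers, and the three blow-ups do not change it ([N3_isomorphic]): away
    from the center, a strict transform is the graph of the polynomial map
    defining the blow-up ([strict_transform_isomorphic]).  The Segre points lie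
    over t = 0 and t = -8 ([segre_quintic_bad]), so the small resolution does
    not change it either ([model_quintic_isomorphic]).

    It remains to see that these open parts are dense.  In Y this is because Y
    is irreducible and the open part contains the point above
    (1 : 2 : 3 : -1 : -2 : -3).  In the fibre square ([square_open_dense]), move
    a given point (p, t, q) with a parameter e: move t, and let p and q vary on
    lines through a fixed center c of the plane which lies on no member of the
    pencil near that of t.  On these lines, the equations of the moving member
    are monic cubics f(e, z) and f'(e, z'), and for generic e all their roots
    give points of the open part.  A polynomial g which vanishes on the open
    part vanishes at the pairs of roots for generic e, hence for all e
    ([monic_pairs_dense]): the remainder of a suitable power of g by a monic
    polynomial vanishes for generic e, so it vanishes identically. *)

Set Implicit Arguments.
Unset Strict Implicit.
Unset Printing Implicit Defensive.

Import GRing.Theory.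
Local Open Scope ring_scope.

(** * Evaluation and substitution of rational polynomials *)

(** Evaluation at a fixed point, as a function of the polynomial. *)
Definition evalAt n (x : 'I_n -> algC) (p : {mpoly rat[n]}) : algC := evalQ p x.

Lemma evalAt_is_zmod_morphism n (x : 'I_n -> algC) : zmod_morphism (evalAt x).
Proof. by move=> p q; rewrite /evalAt /evalQ !rmorphB. Qed.

Lemma evalAt_is_monoid_morphism n (x : 'I_n -> algC) :
  monoid_morphism (evalAt x).
Proof.
by split=> [|p q]; rewrite /evalAt /evalQ ?rmorph1 // !rmorphM.
Qed.

HB.instance Definition _ n (x : 'I_n -> algC) :=
  GRing.isZmodMorphism.Build {mpoly rat[n]} algC (evalAt x)
    (evalAt_is_zmod_morphism x).

HB.instance Definition _ n (x : 'I_n -> algC) :=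
  GRing.isMonoidMorphism.Build {mpoly rat[n]} algC (evalAt x)
    (evalAt_is_monoid_morphism x).

Section EvalQ.
Variables (n : nat) (x : 'I_n -> algC).
Implicit Types p q : {mpoly rat[n]}.

Lemma evalQD p q : evalQ (p + q) x = evalQ p x + evalQ q x.
Proof. exact: (rmorphD (evalAt x)). Qed.

Lemma evalQB p q : evalQ (p - q) x = evalQ p x - evalQ q x.
Proof. exact: (rmorphB (evalAt x)). Qed.

Lemma evalQN p : evalQ (- p) x = - evalQ p x.
Proof. exact: (rmorphN (evalAt x)). Qed.

Lemma evalQM p q : evalQ (p * q) x = evalQ p x * evalQ q x.
Proof. exact: (rmorphM (evalAt x)). Qed.

Lemma evalQ0 : evalQ (0 : {mpoly rat[n]}) x = 0.
Proof. exact: (rmorph0 (evalAt x)). Qed.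

Lemma evalQ1 : evalQ (1 : {mpoly rat[n]}) x = 1.
Proof. exact: (rmorph1 (evalAt x)). Qed.

Lemma evalQMn p k : evalQ (p *+ k) x = evalQ p x *+ k.
Proof. exact: (rmorphMn (evalAt x)). Qed.

Lemma evalQXn p k : evalQ (p ^+ k) x = evalQ p x ^+ k.
Proof. exact: (rmorphXn (evalAt x)). Qed.

Lemma evalQ_sum (I : Type) (r : seq I) (Q : pred I) (F : I -> {mpoly rat[n]}) :
  evalQ (\sum_(i <- r | Q i) F i) x = \sum_(i <- r | Q i) evalQ (F i) x.
Proof. exact: (rmorph_sum (evalAt x)). Qed.

Lemma evalQ_prod (I : Type) (r : seq I) (Q : pred I) (F : I -> {mpoly rat[n]}) :
  evalQ (\prod_(i <- r | Q i) F i) x = \prod_(i <- r | Q i) evalQ (F i) x.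
Proof. exact: (rmorph_prod (evalAt x)). Qed.

Lemma evalQX i : evalQ 'X_i x = x i.
Proof. by rewrite /evalQ map_mpolyX mevalXU. Qed.

Lemma evalQC c : evalQ c%:MP_[n] x = ratr c.
Proof. by rewrite /evalQ map_mpolyC mevalC. Qed.

Lemma eq_evalQ p (y : 'I_n -> algC) : x =1 y -> evalQ p x = evalQ p y.
Proof. exact: meval_eq. Qed.

End EvalQ.

Definition evalQE := (evalQD, evalQN, evalQM, evalQMn, evalQX, evalQ0, evalQ1).

(** A ring morphism from rational polynomials to algebraic numbers is the
    evaluation at the images of the variables. *)
Lemma rmorph_evalQ n (phi : {rmorphism {mpoly rat[n]} -> algC}) p :
  phi p = evalQ p (fun i => phi 'X_i).
Proof.
suff E (h : {rmorphism {mpoly rat[n]} -> algC}) :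
    h p = \sum_(m <- msupp p) ratr p@_m * \prod_(i < n) h 'X_i ^+ m i.
  rewrite E -/(evalAt (fun i => phi 'X_i) p) (E (evalAt (fun i => phi 'X_i))).
  apply: eq_bigr => m _; congr (_ * _); apply: eq_bigr => i _.
  by congr (_ ^+ _); symmetry; exact: evalQX.
rewrite {1}[p]mpolyE rmorph_sum; apply: eq_bigr => m _.
rewrite -mul_mpolyC rmorphM; congr (_ * _).
  exact: (fmorph_eq_rat (h \o @mpolyC n rat)).
rewrite mpolyXE_id rmorph_prod; apply: eq_bigr => i _.
by rewrite rmorphXn.
Qed.

(** Substitution of the polynomials [f i] for the variables of [p]. *)
Definition subst n k (f : 'I_n -> {mpoly rat[k]}) (p : {mpoly rat[n]}) :
  {mpoly rat[k]} := p \mPo [tuple f i | i < n].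

Lemma evalQ_subst n k (f : 'I_n -> {mpoly rat[k]}) p x :
  evalQ (subst f p) x = evalQ p (fun i => evalQ (f i) x).
Proof.
have := rmorph_evalQ
  (evalAt x \o comp_mpoly [tuple f i | i < n]) p.
rewrite /= /evalAt => ->; apply: eq_evalQ => i.
by rewrite comp_mpolyXU -tnth_nth tnth_mktuple.
Qed.

(** * Multihomogeneous polynomials *)

Section Multihomog.
Variable P : multiproj.
Implicit Types (p q : {mpoly rat[ncoord P]}) (d e : 'I_(nfactor P) -> nat).

Lemma multihomog_eq p d e : d =1 e -> multihomog p d -> multihomog p e.
Proof. by move=> de hp m /hp + j => ->. Qed.

Lemma multihomog0 d : @multihomog P 0 d.
Proof. by move=> m; rewrite msupp0. Qed.

Lemma multihomog1 : @multihomog P 1 (fun=> 0%N).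
Proof.
move=> m; rewrite msupp1 inE => /eqP -> j.
by rewrite big1 // => i _; rewrite mnm0E.
Qed.

Lemma multihomogX i : @multihomog P 'X_i (fun j => nat_of_bool (factor_of i == j)).
Proof.
move=> m; rewrite msuppX inE => /eqP -> j.
rewrite big_mkcond (bigD1 i) //= big1 => [|k ki]; rewrite mnm1E.
  by rewrite eqxx addn0; case: ifP.
by rewrite [i == k]eq_sym (negPf ki); case: ifP.
Qed.

Lemma multihomogN p d : multihomog p d -> multihomog (- p) d.
Proof. by move=> hp m; rewrite (perm_mem (msuppN p)); apply: hp. Qed.

Lemma multihomogD p q d :
  multihomog p d -> multihomog q d -> multihomog (p + q) d.
Proof.
move=> hp hq m /msuppD_le; rewrite mem_cat => /orP[]; [exact: hp | exact: hq].
Qed.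

Lemma multihomogB p q d :
  multihomog p d -> multihomog q d -> multihomog (p - q) d.
Proof. by move=> hp /multihomogN; apply: multihomogD. Qed.

Lemma multihomogMn p d k : multihomog p d -> multihomog (p *+ k) d.
Proof.
move=> hp; elim: k => [|k IH]; first by rewrite mulr0n; apply: multihomog0.
by rewrite mulrS; apply: multihomogD.
Qed.

Lemma multihomogM p q d e : multihomog p d -> multihomog q e ->
  multihomog (p * q) (fun j => d j + e j)%N.
Proof.
move=> hp hq m /msuppM_le /allpairsP[[m1 m2] /= [h1 h2 ->]] j.
rewrite -(hp m1 h1 j) -(hq m2 h2 j) -big_split.
by apply: eq_bigr => i _; rewrite mnmDE.
Qed.

Lemma multihomog_sum (I : Type) (r : seq I) (Q : pred I) F d :
  (forall i, Q i -> multihomog (F i) d) ->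
  multihomog (\sum_(i <- r | Q i) F i) d.
Proof.
by move=> hF; apply: (big_ind (fun p => @multihomog P p d)) => //;
  [exact: multihomog0 | move=> ? ?; exact: multihomogD].
Qed.

Lemma multihomog_prod (I : Type) (r : seq I) (Q : pred I) F
    (d : I -> 'I_(nfactor P) -> nat) :
  (forall i, Q i -> multihomog (F i) (d i)) ->
  multihomog (\prod_(i <- r | Q i) F i) (fun j => \sum_(i <- r | Q i) d i j)%N.
Proof.
move=> hF; elim: r => [|i r IH].
  rewrite big_nil; apply: multihomog_eq (multihomog1) => j.
  by rewrite big_nil.
rewrite big_cons; case: ifP => Qi.
  apply: multihomog_eq (multihomogM (hF i Qi) IH) => j.
  by rewrite big_cons Qi.
by apply: multihomog_eq IH => j; rewrite big_cons Qi.
Qed.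

Lemma multihomogXn p d k : multihomog p d ->
  multihomog (p ^+ k) (fun j => k * d j)%N.
Proof.
move=> hp; elim: k => [|k IH]; first exact: multihomog1.
by rewrite exprS; apply: multihomog_eq (multihomogM hp IH) => j; rewrite mulSn.
Qed.

Lemma multihomogZ c p d : multihomog p d -> multihomog (c *: p) d.
Proof. by move=> hp m /msuppZ_le; apply: hp. Qed.

(** Rescaling the coordinates of each factor. *)
Lemma evalQ_scale p d (l : 'I_(nfactor P) -> algC) (x : vec P) :
  multihomog p d ->
  evalQ p (fun i => l (factor_of i) * x i) = (\prod_j l j ^+ d j) * evalQ p x.
Proof.
move=> hp; rewrite [p in LHS]mpolyE [p in RHS]mpolyE !evalQ_sum mulr_sumr.
apply: eq_big_seq => m mp; rewrite -mul_mpolyC mpolyXE_id !evalQM !evalQ_prod.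
rewrite !evalQC mulrCA; congr (_ * _).
transitivity (\prod_(i < ncoord P) (l (factor_of i) ^+ m i * x i ^+ m i)).
  by apply: eq_bigr => i _; rewrite evalQXn evalQX exprMn.
rewrite big_split; congr (_ * _).
  rewrite (partition_big (@factor_of P) xpredT) //=.
  apply: eq_bigr => j _; rewrite -(hp m mp j) -prodrXr.
  by apply: eq_bigr => i /eqP ->.
by apply: eq_bigr => i _; rewrite evalQXn evalQX.
Qed.

End Multihomog.

Lemma multihomog_subst (P Q : multiproj)
    (f : 'I_(ncoord Q) -> {mpoly rat[ncoord P]})
    (e : 'I_(nfactor Q) -> 'I_(nfactor P) -> nat)
    (p : {mpoly rat[ncoord Q]}) (d : 'I_(nfactor Q) -> nat) :
  (forall i, multihomog (f i) (e (factor_of i))) -> multihomog p d ->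
  @multihomog P (subst f p) (fun k => \sum_j d j * e j k)%N.
Proof.
move=> hf hp; rewrite /subst comp_mpolyEX big_seq.
apply: multihomog_sum => m mp; apply: multihomogZ; rewrite comp_mpolyX.
have hX (i : 'I_(ncoord Q)) : @multihomog P
    (tnth [tuple f i | i < ncoord Q] i ^+ m i)
    (fun k => m i * e (factor_of i) k)%N.
  by rewrite tnth_mktuple; apply: multihomogXn.
apply: multihomog_eq (multihomog_prod (fun i _ => hX i)) => k.
rewrite (partition_big (@factor_of Q) xpredT) //=; apply: eq_bigr => j _.
by rewrite -(hp m mp j) big_distrl; apply: eq_bigr => i /eqP ->.
Qed.

(** * Points, closure and regular maps *)

Section Points.
Variable P : multiproj.
Implicit Types (x y z : vec P) (A B : pset P) (p : {mpoly rat[ncoord P]}).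

Lemma same_point_refl x : same_point x x.
Proof. by exists (fun=> 1) => [j|i]; rewrite ?oner_neq0 ?mul1r. Qed.

Lemma eq_same_point x y : x =1 y -> same_point x y.
Proof. by move=> xy; exists (fun=> 1) => [j|i]; rewrite ?oner_neq0 ?mul1r. Qed.

Lemma same_point_sym x y : same_point x y -> same_point y x.
Proof.
case=> l l0 yE; exists (fun j => (l j)^-1) => [j|i]; first by rewrite invr_eq0.
by rewrite yE mulKf.
Qed.

Lemma same_point_trans y x z : same_point x y -> same_point y z -> same_point x z.
Proof.
case=> l l0 yE [l' l'0 zE]; exists (fun j => l' j * l j) => [j|i].
  by rewrite mulf_neq0.
by rewrite zE yE mulrA.
Qed.

Lemma is_point_same x y : same_point x y -> is_point x -> is_point y.
Proof.
case=> l l0 yE px j; have [i ij xi] := px j; exists i => //.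
by rewrite yE mulf_neq0.
Qed.

Lemma same_point_zero p d x y : multihomog p d -> same_point x y ->
  evalQ p x = 0 -> evalQ p y = 0.
Proof.
move=> hp [l l0 yE] px; rewrite (eq_evalQ p yE) (evalQ_scale l x hp).
by rewrite px mulr0.
Qed.

Lemma same_point_neq0 p d x y : multihomog p d -> same_point x y ->
  evalQ p x != 0 -> evalQ p y != 0.
Proof.
move=> hp xy; apply: contraNneq => py.
by apply/eqP; apply: same_point_zero hp (same_point_sym xy) py.
Qed.

Lemma closure_vanish A p d :
  multihomog p d -> vanishes_on p A -> vanishes_on p (closure A).
Proof. by move=> hp pA x [_]; apply; eassumption. Qed.

Lemma sub_closure A x : is_point x -> A x -> closure A x.
Proof. by move=> px Ax; split=> // p d hp; apply. Qed.

Lemma closureS A B x : (forall y, A y -> B y) -> closure A x -> closure B x.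
Proof.
move=> AB [px clx]; split=> // p d hp pB; apply: clx hp _ => y Ay.
exact: pB (AB _ Ay).
Qed.

Lemma closed_closure A : @closed P (closure A).
Proof.
move=> x; split=> [clx|[px clx]]; first by apply: sub_closure => //; case: clx.
by split=> // p d hp /(closure_vanish hp); apply: clx hp.
Qed.

Lemma closed_zeros p d : multihomog p d ->
  closed (fun x => is_point x /\ evalQ p x = 0).
Proof.
move=> hp x; split=> [[px p0]|[px clx]]; first exact: sub_closure.
by split=> //; apply: clx hp _ => y [].
Qed.

Lemma closed_is_point A x : closed A -> A x -> is_point x.
Proof. by move=> clA /clA[]. Qed.

(** A nonempty open subset of a closed irreducible set is dense. *)
Lemma irreducible_open_dense A (U : pset P) : closed A ->
  irreducible A -> open_in U A -> (exists x, U x) -> dense_in U A.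
Proof.
move=> clA [_ irr] [C clC UE] [x0 Ux0].
case: (irr (closure U) C (closed_closure U) clC) => [x Ax|//|AC].
  case: (classic (C x)) => [|nCx]; [by right | left].
  by apply: sub_closure (closed_is_point clA Ax) _; apply/UE.
by case/UE: Ux0 => Ax0 []; apply: AC.
Qed.

End Points.

Lemma evalQ_same (P Q : multiproj) (f : 'I_(ncoord Q) -> {mpoly rat[ncoord P]})
    e (x y : vec P) :
  (forall i, multihomog (f i) (e (factor_of i))) -> same_point x y ->
  @same_point Q (fun i => evalQ (f i) x) (fun i => evalQ (f i) y).
Proof.
move=> hf [l l0 yE]; exists (fun j => \prod_k l k ^+ e j k) => [j|i].
  by apply/prodf_neq0 => k _; rewrite expf_neq0.
by rewrite (eq_evalQ _ yE) (evalQ_scale l x (hf i)).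
Qed.

(** For a map given by the polynomials [f], multiplying by one nonzero
    coordinate from each factor excludes the vectors where [f] does not define
    a point. *)
Lemma point_denominator (P Q : multiproj)
    (f : 'I_(ncoord Q) -> {mpoly rat[ncoord P]}) e (x : vec P) :
  (forall i, multihomog (f i) (e (factor_of i))) ->
  @is_point Q (fun i => evalQ (f i) x) ->
  exists (M : {mpoly rat[ncoord P]}) (d : 'I_(nfactor P) -> nat),
    [/\ multihomog M d, evalQ M x != 0
      & forall y, evalQ M y != 0 -> @is_point Q (fun i => evalQ (f i) y)].
Proof.
move=> hf px.
have hc (j : 'I_(nfactor Q)) :
    exists i, (factor_of i == j) && (evalQ (f i) x != 0).
  by have [i ij fi] := px j; exists i; rewrite ij eqxx.
pose c j := xchoose (hc j).
have cP j : factor_of (c j) = j /\ evalQ (f (c j)) x != 0.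
  by have /andP[/eqP] := xchooseP (hc j).
exists (\prod_j f (c j)), (fun k => \sum_j e (factor_of (c j)) k)%N; split.
- by apply: multihomog_prod.
- by rewrite evalQ_prod; apply/prodf_neq0 => j _; have [] := cP j.
move=> y; rewrite evalQ_prod => /prodf_neq0 hy j; exists (c j).
  by have [] := cP j.
exact: hy.
Qed.

Section Regular.
Variables (P Q R : multiproj).
Implicit Types (A : pset P) (B : pset Q) (C : pset R).

Lemma regular_same A B phi x y :
  @regular_map P Q A B phi -> A x -> A y -> same_point x y ->
  same_point (phi x) (phi y).
Proof.
case=> _ reg Ax Ay xy; have [f [e [hf pf fE]]] := reg x Ax.
have fxy := evalQ_same hf xy.
have fEy := fE y Ay (is_point_same fxy pf).
exact: same_point_trans (fE x Ax pf) (same_point_trans fxy (same_point_sym fEy)).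
Qed.

Lemma regular_sub A A' B B' phi : @regular_map P Q A B phi ->
  (forall x, A' x -> A x) -> (forall x, A' x -> B' (phi x)) ->
  regular_map A' B' phi.
Proof.
case=> _ reg AA' AB'; split=> // x A'x.
have [f [e [hf pf fE]]] := reg x (AA' x A'x).
by exists f, e; split=> // y /AA'; apply: fE.
Qed.

Lemma regular_comp A B C phi psi :
  @regular_map P Q A B phi -> @regular_map Q R B C psi ->
  regular_map A C (fun x => psi (phi x)).
Proof.
case=> AB regphi [BC regpsi]; split=> [x /AB/BC //|x Ax].
have [f [e [hf pf fE]]] := regphi x Ax.
have [g [e' [hg pg gE]]] := regpsi (phi x) (AB x Ax).
have [M [d [hM Mx MP]]] := point_denominator hf pf.
(* Multiplying by M ensures that f y is a point wherever the new polynomials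
   define one. *)
have sE i y : evalQ (M * subst f (g i)) y =
    evalQ M y * evalQ (g i) (fun k => evalQ (f k) y).
  by rewrite evalQM evalQ_subst.
exists (fun i => M * subst f (g i)),
  (fun j k => (d k + \sum_j' e' j j' * e j' k)%N); split.
- by move=> i; apply: multihomogM hM (multihomog_subst hf (hg i)).
- have pgf := is_point_same (evalQ_same hg (fE x Ax pf)) pg.
  move=> j; have [i ij gi] := pgf j; exists i => //.
  by rewrite sE mulf_neq0.
move=> y Ay py.
have pgf : @is_point R (fun i => evalQ (g i) (fun k => evalQ (f k) y)).
  move=> j; have [i ij] := py j; rewrite sE mulf_eq0 negb_or => /andP[_ gi].
  by exists i.
have My (j : 'I_(nfactor R)) : evalQ M y != 0.
  by have [i _] := py j; rewrite sE mulf_eq0 negb_or => /andP[].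
(* M y != 0 is read off a coordinate of the image; if the target has no
   factor, there is none, but then every two vectors are the same point. *)
case: (pickP (fun _ : 'I_(nfactor R) => true)) => [j0 _|R0]; last first.
  exists (fun=> 1) => [j|i]; first by rewrite oner_neq0.
  by have := R0 (factor_of i).
have fEy := fE y Ay (MP y (My j0)).
have gfE := evalQ_same hg fEy.
have gfp := is_point_same (same_point_sym gfE) pgf.
apply: same_point_trans (same_point_trans (gE _ (AB y Ay) gfp) gfE) _.
by exists (fun=> evalQ M y) => [j|i]; [exact: My | rewrite sE].
Qed.

(** The preimage of a closed set under a regular map is closed in the source. *)
Lemma regular_preimage A B phi p d y : @regular_map P Q A B phi ->
  @multihomog Q p d -> A y -> closure (fun x => A x /\ evalQ p (phi x) = 0) y ->
  evalQ p (phi y) = 0.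
Proof.
case=> AB reg hp Ay [_ cly].
have [f [e [hf pf fE]]] := reg y Ay.
have [M [dM [hM My MP]]] := point_denominator hf pf.
have := cly _ _ (multihomogM hM (multihomog_subst hf hp)).
rewrite evalQM evalQ_subst => /(_ _)/eqP; rewrite mulf_eq0 (negPf My) /=.
move=> H; apply: (same_point_zero hp (same_point_sym (fE y Ay pf))).
apply/eqP; apply: H => x [Ax px]; rewrite evalQM evalQ_subst.
have [->|Mx] := eqVneq (evalQ M x) 0; first by rewrite mul0r.
by rewrite (same_point_zero hp (fE x Ax (MP x Mx)) px) mulr0.
Qed.

End Regular.

Lemma mutually_inverse_sym (P Q : multiproj) (A : pset P) (B : pset Q) phi psi :
  mutually_inverse A B phi psi -> mutually_inverse B A psi phi.
Proof. by case. Qed.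

Lemma mutually_inverse_sub (P Q : multiproj) (A A' : pset P) (B B' : pset Q)
    phi psi :
  mutually_inverse A B phi psi ->
  (forall x, A' x -> A x) -> (forall y, B' y -> B y) ->
  (forall x, A' x -> B' (phi x)) -> (forall y, B' y -> A' (psi y)) ->
  mutually_inverse A' B' phi psi.
Proof.
case=> regphi regpsi idA idB AA BB AB BA; split.
- exact: regular_sub regphi AA AB.
- exact: regular_sub regpsi BB BA.
- by move=> x /AA/idA.
- by move=> y /BB/idB.
Qed.

Lemma isomorphic_sym (P Q : multiproj) (A : pset P) (B : pset Q) :
  isomorphic A B -> isomorphic B A.
Proof. by case=> phi [psi /mutually_inverse_sym]; exists psi, phi. Qed.

Lemma isomorphic_trans (P Q R : multiproj) (A : pset P) (B : pset Q)
    (C : pset R) :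
  isomorphic A B -> isomorphic B C -> isomorphic A C.
Proof.
case=> phi [psi [rphi rpsi idA idB]] [phi' [psi' [rphi' rpsi' idB' idC]]].
case: (rphi) (rpsi) (rphi') (rpsi') => AB _ [BA _] [BC _] [CB _].
exists (fun x => phi' (phi x)), (fun z => psi (psi' z)); split.
- exact: regular_comp rphi rphi'.
- exact: regular_comp rpsi' rpsi.
- move=> x Ax; apply: same_point_trans (idA x Ax) _.
  by apply: regular_same rpsi _ _ (idB' _ (AB x Ax)); auto.
- move=> z Cz; apply: same_point_trans (idC z Cz) _.
  by apply: regular_same rphi' _ _ (idB _ (CB z Cz)); auto.
Qed.

(** * Products and blow-ups *)

Section Products.
Variables P Q : multiproj.
Local Notation PQ := (prodsp P Q).
Implicit Types (x : vec P) (y : vec Q) (z : vec PQ).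

Lemma split_lshift m n (i : 'I_m) : split (lshift n i) = inl i.
Proof. exact: (unsplitK (inl i)). Qed.

Lemma split_rshift m n (i : 'I_n) : split (rshift m i) = inr i.
Proof. exact: (unsplitK (inr i)). Qed.

Lemma factor_lshift i : @factor_of PQ (lshift (ncoord Q) i) =
  lshift (nfactor Q) (factor_of i).
Proof. by rewrite /= split_lshift. Qed.

Lemma factor_rshift i : @factor_of PQ (rshift (ncoord P) i) =
  rshift (nfactor P) (factor_of i).
Proof. by rewrite /= split_rshift. Qed.

Lemma fstv_pair x y : fstv (pairv x y) = x.
Proof.
by apply: functional_extensionality => i; rewrite /fstv /pairv split_lshift.
Qed.

Lemma sndv_pair x y : sndv (pairv x y) = y.
Proof.
by apply: functional_extensionality => i; rewrite /sndv /pairv split_rshift.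
Qed.

Lemma is_point_prod z : is_point z <-> is_point (fstv z) /\ is_point (sndv z).
Proof.
split=> [pz|[p1 p2] j].
  split=> j.
    have [i] := pz (lshift _ j); rewrite -[i]splitK; case: (split i) => k /=.
      by rewrite split_lshift => /lshift_inj <- zk; exists k.
    by rewrite split_rshift => /eqP; rewrite eq_rlshift.
  have [i] := pz (rshift _ j); rewrite -[i]splitK; case: (split i) => k /=.
    by rewrite split_lshift => /eqP; rewrite eq_lrshift.
  by rewrite split_rshift => /rshift_inj <- zk; exists k.
rewrite -[j]splitK; case: (split j) => k /=.
  have [i ik zi] := p1 k; exists (lshift _ i) => //.
  by rewrite ?factor_lshift /= ?split_lshift ik.
have [i ik zi] := p2 k; exists (rshift _ i) => //.
by rewrite ?factor_rshift /= ?split_rshift ik.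
Qed.

Lemma same_point_prod z z' : same_point z z' <->
  same_point (fstv z) (fstv z') /\ same_point (sndv z) (sndv z').
Proof.
split=> [[l l0 zE]|[[l1 l10 E1] [l2 l20 E2]]].
  split.
    exists (fun j => l (lshift _ j)) => [j|i]; first exact: l0.
    by rewrite /fstv zE factor_lshift.
  exists (fun j => l (rshift _ j)) => [j|i]; first exact: l0.
  by rewrite /sndv zE factor_rshift.
exists (fun j => match split j with inl k => l1 k | inr k => l2 k end).
  by move=> j; case: (split j).
move=> i; rewrite -[i]splitK; case: (split i) => k /=.
  by rewrite !split_lshift; apply: E1.
by rewrite !split_rshift; apply: E2.
Qed.

Lemma multihomog_lshift i : @multihomog PQ 'X_(lshift (ncoord Q) i)
  (fun j => nat_of_bool (lshift (nfactor Q) (factor_of i) == j)).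
Proof.
apply: (@multihomog_eq PQ _ _ _ _ (@multihomogX PQ _)) => j.
by rewrite factor_lshift.
Qed.

Lemma multihomog_rshift i : @multihomog PQ 'X_(rshift (ncoord P) i)
  (fun j => nat_of_bool (rshift (nfactor P) (factor_of i) == j)).
Proof.
apply: (@multihomog_eq PQ _ _ _ _ (@multihomogX PQ _)) => j.
by rewrite factor_rshift.
Qed.

(** The pullback of a polynomial under the first projection. *)
Definition pull_fst (p : {mpoly rat[ncoord P]}) : {mpoly rat[ncoord PQ]} :=
  subst (fun i => 'X_(lshift (ncoord Q) i)) p.

Lemma evalQ_pull_fst p z : evalQ (pull_fst p) z = evalQ p (fstv z).
Proof. by rewrite evalQ_subst; apply: eq_evalQ => i; rewrite evalQX. Qed.

Lemma multihomog_pull_fst p d : @multihomog P p d ->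
  @multihomog PQ (pull_fst p)
    (fun k => \sum_j d j * (lshift (nfactor Q) j == k))%N.
Proof. by apply: multihomog_subst => i; apply: multihomog_lshift. Qed.

Lemma regular_fst (A : pset PQ) (B : pset P) :
  (forall z, A z -> is_point z) -> (forall z, A z -> B (fstv z)) ->
  regular_map A B (@fstv P Q).
Proof.
move=> Ap AB; split=> // z Az.
exists (fun i => 'X_(lshift (ncoord Q) i)),
  (fun j k => nat_of_bool (lshift (nfactor Q) j == k)); split.
- exact: multihomog_lshift.
- have /is_point_prod[pz _] := Ap z Az.
  by apply: is_point_same pz; apply: eq_same_point => i; rewrite evalQX.
- by move=> z' _ _; apply: eq_same_point => i; rewrite evalQX.
Qed.

(** The graph of a map given by polynomials of one common multidegree on each
    factor. *)
Lemma regular_graph (A : pset P) (B : pset PQ)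
    (f : 'I_(ncoord Q) -> {mpoly rat[ncoord P]}) e :
  (forall i, multihomog (f i) (e (factor_of i))) ->
  (forall x, A x -> is_point x) ->
  (forall x, A x -> @is_point Q (fun i => evalQ (f i) x)) ->
  (forall x, A x -> B (pairv x (fun i => evalQ (f i) x))) ->
  regular_map A B (fun x => pairv x (fun i => evalQ (f i) x)).
Proof.
move=> hf Ap Afp AB; split=> // x Ax.
pose F (i : 'I_(ncoord PQ)) : {mpoly rat[ncoord P]} :=
  match split i with inl k => 'X_k | inr k => f k end.
pose d (j : 'I_(nfactor PQ)) : 'I_(nfactor P) -> nat :=
  match split j with inl k => fun k' => nat_of_bool (k == k') | inr k => e k end.
have FE (y : vec P) : (fun i => evalQ (F i) y) =1 pairv y (fun i => evalQ (f i) y).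
  by move=> i; rewrite /F /pairv; case: (split i) => k //; rewrite evalQX.
exists F, d; split.
- move=> i; rewrite -[i]splitK; case: (split i) => k /=.
    by rewrite /d /F !split_lshift; apply: multihomogX.
  by rewrite /d /F !split_rshift; apply: hf.
- apply: is_point_same (eq_same_point (fsym (FE x))) _.
  by apply/is_point_prod; rewrite fstv_pair sndv_pair; split; auto.
- by move=> y Ay _; apply: eq_same_point (fsym (FE y)).
Qed.

End Products.

Section Blowups.
Variables (P : multiproj) (X Z : pset P) (E : center_equations X Z).
Local Notation n := (ce_size E).
Local Notation cpol := (@ce_poly P X Z E).
Local Notation BP := (prodsp P (projsp n)).

(** The rational map to a projective space whose graph is closed up in the
    blow-up. *)
Definition ce_map (x : vec P) : vec (projsp n) := fun k => evalQ (cpol k) x.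

(** This map is defined at the points of X where some equation of the center
    does not vanish. *)
Lemma ce_map_point g x : X x -> is_point x -> vanishes_on g Z ->
  evalQ g x != 0 -> is_point (ce_map x).
Proof.
move=> Xx px gZ gx.
have hc (j : 'I_(nfactor P)) : exists i, (factor_of i == j) && (x i != 0).
  by have [i ij xi] := px j; exists i; rewrite ij eqxx.
pose c j := xchoose (hc j).
have cP j : factor_of (c j) = j /\ x (c j) != 0.
  by have /andP[/eqP] := xchooseP (hc j).
have [N [q [h [hX E0]]]] := @ce_gen P X Z E g gZ _ (fun j => (cP j).1).
case: (pickP (fun k => evalQ (cpol k) x != 0)) => [k xk j|x0].
  by exists k => //; rewrite !ord1.
move/(congr1 (evalAt x)): E0; rewrite /evalAt.
rewrite evalQM evalQXn evalQD evalQ_sum hX // addr0 [RHS]big1 => [|k _]; last first.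
  by rewrite evalQM (eqP (negbFE (x0 k))) mulr0.
move/eqP; rewrite mulf_eq0 (negPf gx) orbF expf_eq0 evalQ_prod => /andP[_].
rewrite (_ : _ == 0 = false) //; apply/negbTE/prodf_neq0 => j _.
by rewrite evalQX; have [] := cP j.
Qed.

Lemma strict_transform_closed W : closed (strict_transform (E := E) W).
Proof. exact: closed_closure. Qed.

Lemma strict_transform_sub W z :
  strict_transform (E := E) W z -> blowup (E := E) z.
Proof.
by move=> Wz; apply/closed_closure; apply: closureS Wz => y [].
Qed.

Lemma strict_transform_vanish W g d : @multihomog P g d -> vanishes_on g W ->
  vanishes_on (pull_fst (projsp n) g) (strict_transform (E := E) W).
Proof.
move=> hg gW; rewrite /strict_transform.
refine (@closure_vanish BP _ _ _ (multihomog_pull_fst (Q := projsp n) hg) _).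
by move=> z [_ Wz _]; rewrite evalQ_pull_fst gW.
Qed.

(** Away from the center, the strict transform of [W] is the graph over [W]. *)
Lemma strict_transformE W g (z : vec BP) :
  closed W -> (forall x, W x -> X x) -> vanishes_on g Z ->
  evalQ g (fstv z) != 0 ->
  strict_transform (E := E) W z <->
    W (fstv z) /\ same_point (ce_map (fstv z)) (sndv z).
Proof.
move=> clW WX gZ gz; split=> [Wz|[Wz sz]]; last first.
  have nZ : ~ Z (fstv z) by move/gZ/eqP; rewrite (negPf gz).
  have pz := closed_is_point clW Wz.
  have pcz := is_point_same sz (ce_map_point (WX _ Wz) pz gZ gz).
  have pt : is_point z by apply/is_point_prod.
  apply: sub_closure => //; split=> //.
  by apply: sub_closure => //; split=> //; apply: WX.
have pz : is_point z by case: Wz.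
have /is_point_prod[p1 p2] := pz.
have Wz1 : W (fstv z).
  apply/clW; split=> // p d hp pW.
  by rewrite -(evalQ_pull_fst (Q := projsp n)) (strict_transform_vanish hp pW Wz).
split=> //.
(* The proportionality of the two vectors of coordinates is a closed
   condition, which holds on the graph. *)
have minor k l :
    evalQ (cpol k) (fstv z) * sndv z l =
    evalQ (cpol l) (fstv z) * sndv z k.
  pose m k l : {mpoly rat[ncoord BP]} :=
    pull_fst (projsp n) (cpol k) * 'X_(rshift (ncoord P) l).
  have mE a b y : evalQ (m a b) y = evalQ (cpol a) (fstv y) * sndv y b.
    by rewrite evalQM evalQ_pull_fst evalQX.
  have hm a b := multihomogM (multihomog_pull_fst (Q := projsp n) (@ce_homog P X Z E a))
    (@multihomog_rshift P (projsp n) b).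
  have hB := multihomogB (hm k l) (hm l k).
  apply/eqP; rewrite -!mE -subr_eq0 -evalQB; apply/eqP.
  apply: (@closure_vanish BP _ _ _ hB) (strict_transform_sub Wz) => y [_ _ [c c0 yE]].
  by rewrite evalQB !mE !yE /=; ring.
have [k0 _ ck0] := ce_map_point (WX _ Wz1) p1 gZ gz ord0.
have [l0 _ zl0] := p2 ord0.
have zk0 : sndv z k0 != 0.
  have := minor k0 l0; move=> /eqP; apply: contraTneq => ->.
  by rewrite mulr0 mulf_neq0.
exists (fun=> sndv z k0 / ce_map (fstv z) k0) => [j|l].
  by rewrite mulf_neq0 // invr_neq0.
apply: (mulfI ck0); rewrite [LHS]minor mulrA mulrCA mulfV // mulr1.
exact: mulrC.
Qed.

(** Blowing down identifies the open parts lying over the complement of the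
    center. *)
Lemma strict_transform_isomorphic W g (H : pset P) :
  closed W -> (forall x, W x -> X x) -> vanishes_on g Z ->
  (forall x, H x -> evalQ g x != 0) ->
  isomorphic (fun x => W x /\ H x)
    (fun z : vec BP => strict_transform (E := E) W z /\ H (fstv z)).
Proof.
move=> clW WX gZ Hg.
have Wp x : W x -> is_point x by apply: closed_is_point.
exists (fun x => pairv x (ce_map x)), (@fstv P (projsp n)); split.
- apply: (regular_graph (e := fun=> @ce_deg P X Z E)).
  + by move=> k; apply: ce_homog.
  + by move=> x [/Wp].
  + by move=> x [Wx Hx]; apply: ce_map_point (WX _ Wx) (Wp _ Wx) gZ (Hg _ Hx).
  + move=> x [Wx Hx]; rewrite fstv_pair; split=> //.
    apply/(strict_transformE clW WX gZ); rewrite fstv_pair ?sndv_pair.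
      exact: Hg.
    by split=> //; apply: same_point_refl.
- apply: regular_fst => z [Wz Hz]; first by case: Wz.
  by have [Wz1 _] := (strict_transformE clW WX gZ (Hg _ Hz)).1 Wz.
- by move=> x _; rewrite fstv_pair; apply: same_point_refl.
- move=> z [Wz Hz]; apply/same_point_prod; rewrite fstv_pair sndv_pair.
  have [_ sz] := (strict_transformE clW WX gZ (Hg _ Hz)).1 Wz.
  by split; [exact: same_point_refl | exact: same_point_sym].
Qed.

End Blowups.

(** * The Barth-Nieto tower *)

(** The product of the six coordinates, which vanishes on every center. *)
Definition coord_prod : {mpoly rat[ncoord (projsp 5)]} := \prod_(i < 6) 'X_i.

Lemma coord_prod_homog : exists d, @multihomog (projsp 5) coord_prod d.
Proof.
by eexists; apply: multihomog_prod => i _; apply: (multihomogX (P := projsp 5)).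
Qed.

Lemma coord_prodE x : evalQ coord_prod x = \prod_(i < 6) x i.
Proof. by rewrite evalQ_prod; apply: eq_bigr => i _; rewrite evalQX. Qed.

Lemma coord_prod_strata k : (0 < k)%N -> vanishes_on coord_prod (coord_strata k).
Proof.
move=> k0 x [_ [S Sk S0]]; rewrite coord_prodE.
have /card_gt0P[i iS] : (0 < #|S|)%N by rewrite Sk.
by rewrite (bigD1 i) //= S0 // mul0r.
Qed.

Lemma P0_quintic x : barth_nieto_quintic x -> P0 x.
Proof. by case. Qed.

(** The two equations of the Barth-Nieto quintic in P_5. *)
Definition coord_sum : {mpoly rat[ncoord (projsp 5)]} := \sum_(i < 6) 'X_i.

Definition quintic_poly : {mpoly rat[ncoord (projsp 5)]} :=
  \sum_(j < 6) \prod_(i < 6 | i != j) 'X_i.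

Lemma barth_nieto_quintic_closed : closed barth_nieto_quintic.
Proof.
have hs : @multihomog (projsp 5) coord_sum (fun=> 1%N).
  apply: multihomog_sum => i _.
  apply: (@multihomog_eq (projsp 5) _ _ _ _ (@multihomogX (projsp 5) _)) => j.
  by rewrite !ord1.
have hq : @multihomog (projsp 5) quintic_poly (fun=> 5%N).
  apply: multihomog_sum => j _.
  apply: (@multihomog_eq (projsp 5) _ _ _ _
    (multihomog_prod (fun i _ => @multihomogX (projsp 5) i))) => k.
  rewrite (eq_bigr (fun=> 1%N)) => [|i _]; last by rewrite !ord1.
  by rewrite sum1_card cardC1 card_ord.
have sE x : evalQ coord_sum x = \sum_(i < 6) x i.
  by rewrite evalQ_sum; apply: eq_bigr => i _; rewrite evalQX.
have qE x : evalQ quintic_poly x = \sum_(j < 6) \prod_(i < 6 | i != j) x i.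
  rewrite evalQ_sum; apply: eq_bigr => j _; rewrite evalQ_prod.
  by apply: eq_bigr => i _; rewrite evalQX.
move=> x; split=> [Nx|[px clx]].
  by apply: sub_closure => //; case: Nx => [[]].
split; first split=> //.
  by rewrite -sE; apply: clx hs _ => y [[_ +] _]; rewrite sE.
by rewrite -qE; apply: clx hq _ => y [_]; rewrite qE.
Qed.

(** The projection from the total space of the tower to [P_5]. *)
Definition tower_base (T : barth_nieto_tower) (z : vec (N3_space T)) :
    vec (projsp 5) :=
  fstv (P := projsp 5)
    (fstv (P := blowup_space (bnt1 T)) (fstv (P := blowup_space (bnt2 T)) z)).

(** Where no coordinate vanishes, the three blow-ups do not change the
    quintic. *)
Lemma N3_isomorphic T (H : pset (projsp 5)) :
  (forall x, H x -> evalQ coord_prod x != 0) ->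
  isomorphic (fun x => barth_nieto_quintic x /\ H x)
    (fun z => N3 (T := T) z /\ H (tower_base z)).
Proof.
move=> Hg; have [d hd] := coord_prod_homog.
have g1 : vanishes_on coord_prod (coord_strata 4) by apply: coord_prod_strata.
pose ST := strict_transform_vanish.
have g2 := ST _ _ _ (bnt1 T) _ _ _ hd (coord_prod_strata (k := 3) isT).
have h2 := multihomog_pull_fst (Q := projsp (ce_size (bnt1 T))) hd.
have g3 := ST _ _ _ (bnt1 T) _ _ _ hd (coord_prod_strata (k := 2) isT).
have {}g3 := ST _ _ _ (bnt2 T) _ _ _ h2 g3.
apply: isomorphic_trans
  (strict_transform_isomorphic (bnt1 T) barth_nieto_quintic_closed
    P0_quintic g1 Hg) _.
apply: isomorphic_trans
  (strict_transform_isomorphic (bnt2 T) (W := strict_transform (E := bnt1 T) _)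
    (H := fun z => H (fstv z)) (strict_transform_closed _)
    (strict_transform_sub (W := _)) g2 _) _.
  by move=> z Hz; rewrite evalQ_pull_fst; apply: Hg.
apply: (strict_transform_isomorphic (bnt3 T)
    (W := strict_transform (E := bnt2 T) _)
    (H := fun z => H (fstv (fstv z))) (strict_transform_closed _)
    (strict_transform_sub (W := _)) g3 _).
by move=> z Hz; rewrite !evalQ_pull_fst; apply: Hg.
Qed.

(** * Roots of monic polynomials *)

Section MonicRoots.
Variables (R : comNzRingType) (k : closedFieldType).
Implicit Types (f g : {poly R}) (phi : {rmorphism R -> k}).

(** Evaluation at [z], after [phi] on the coefficients. *)
Definition spec phi (z : k) : {rmorphism {poly R} -> k} :=
  horner_eval z \o map_poly phi.

Lemma specE phi z g : spec phi z g = (map_poly phi g).[z].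
Proof. by []. Qed.

Lemma specC phi z c : spec phi z c%:P = phi c.
Proof. by rewrite specE map_polyC hornerC. Qed.

Lemma specX phi z : spec phi z 'X = z.
Proof. by rewrite specE map_polyX hornerX. Qed.

(** By the Nullstellensatz in one variable, a power of [g] is divisible by [f]
    after specialization. *)
Lemma rmodp_spec0 phi f g : f \is monic ->
  (forall z, spec phi z f = 0 -> spec phi z g = 0) ->
  map_poly phi (Pdiv.CommonRing.rmodp (g ^+ size f) f) = 0.
Proof.
move=> mf fg; set r := Pdiv.CommonRing.rmodp _ f.
have mF : map_poly phi f \is monic by apply: monic_map.
have sF : size (map_poly phi f) = size f.
  by apply: size_map_poly_id0; rewrite (monicP mf) rmorph1 oner_neq0.
have [rs FE] := closed_field_poly_normal (map_poly phi f).
rewrite (monicP mF) scale1r in FE.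
have dvdF : map_poly phi f %| map_poly phi g ^+ size f.
  have le : (size rs <= size f)%N.
    by rewrite -sF FE size_prod_XsubC leqnSn.
  apply: dvdp_trans (dvdp_exp2l _ le).
  have : {subset rs <= root (map_poly phi g)}.
    move=> z zrs; rewrite -topredE /=; apply/rootP; apply: fg; rewrite specE; apply/rootP.
    by rewrite FE root_prod_XsubC.
  rewrite FE; elim: rs {FE le} => [|z rs IH] sub; first by rewrite big_nil.
  rewrite big_cons exprS dvdp_mul //.
    by rewrite dvdp_XsubCl; apply: sub; rewrite mem_head.
  by apply: IH => y yrs; apply: sub; rewrite inE yrs orbT.
have dvdr : map_poly phi f %| map_poly phi r.
  have /(congr1 (map_poly phi)) := Pdiv.RingMonic.rdivp_eq mf (g ^+ size f).
  rewrite rmorphD rmorphM rmorphXn -/r => E.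
  by rewrite -(dvdp_addr _ (dvdp_mulIr (map_poly phi
    (Pdiv.CommonRing.rdivp (g ^+ size f) f)) _)) -E.
apply/eqP; apply: contraTT dvdr => r0; apply/negP => /(dvdp_leq r0).
rewrite sF leqNgt => /negP; apply; apply: leq_ltn_trans (size_poly _ _) _.
by rewrite Pdiv.CommonRing.ltn_rmodpN0 // monic_neq0.
Qed.

(** If every element of [R] which vanishes at all points of [G] vanishes at all
    points of [A], then the same holds for elements of [R[z]] on the loci
    [f = 0] over [G] and [A]. *)
Lemma monic_roots_dense (I : Type) (ev : I -> {rmorphism R -> k})
    (G A : I -> Prop) f :
  f \is monic ->
  (forall r, (forall i, G i -> ev i r = 0) -> forall i, A i -> ev i r = 0) ->
  forall g,
  (forall i z, G i -> spec (ev i) z f = 0 -> spec (ev i) z g = 0) ->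
  forall i z, A i -> spec (ev i) z f = 0 -> spec (ev i) z g = 0.
Proof.
move=> mf GA g Gg i z Ai fz.
have r0 : map_poly (ev i) (Pdiv.CommonRing.rmodp (g ^+ size f) f) = 0.
  apply/polyP => j; rewrite coef_map coef0; apply: GA Ai => i' Gi'.
  have /polyP/(_ j) := rmodp_spec0 mf (fun z => Gg i' z Gi').
  by rewrite coef_map coef0.
have /(congr1 (spec (ev i) z)) := Pdiv.RingMonic.rdivp_eq mf (g ^+ size f).
rewrite rmorphXn rmorphD rmorphM fz mulr0 add0r [RHS]specE r0 horner0.
by move/eqP; rewrite expf_eq0 => /andP[_ /eqP].
Qed.

End MonicRoots.

(** [Q] holds outside the zeros of some nonzero polynomial. *)
Definition generic (k : fieldType) (Q : k -> Prop) : Prop :=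
  exists2 s : {poly k}, s != 0 & forall e, s.[e] != 0 -> Q e.

Section Generic.
Variable k : closedFieldType.
Implicit Types (Q : k -> Prop) (a b : k).

Lemma generic_and Q1 Q2 :
  generic Q1 -> generic Q2 -> generic (fun e => Q1 e /\ Q2 e).
Proof.
case=> s s0 sQ [t t0 tQ]; exists (s * t); first by rewrite mulf_neq0.
by move=> e; rewrite hornerM mulf_eq0 negb_or => /andP[/sQ ? /tQ].
Qed.

Lemma generic_impl Q1 Q2 :
  generic Q1 -> (forall e, Q1 e -> Q2 e) -> generic Q2.
Proof. by case=> s s0 sQ Q12; exists s => // e /sQ/Q12. Qed.

Lemma generic_lin a b : (a != 0) || (b != 0) -> generic (fun e => a + e * b != 0).
Proof.
move=> ab; exists (a%:P + b *: 'X) => [|e]; last first.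
  by rewrite !hornerE mulrC.
apply: contraTneq ab => /polyP s0; have := s0 0%N; have := s0 1%N.
rewrite !coefE /= !(mulr0, mulr1, addr0, add0r) => -> ->.
by rewrite eqxx.
Qed.

Lemma closed_field_infinite (p : {poly k}) :
  (forall e, p.[e] = 0) -> p = 0.
Proof.
move=> p0; apply/eqP; case: (eqVneq p 0) => // nz.
have [e] := closed_nonrootP _ nz; rewrite rootE p0 eqxx //.
Qed.

Lemma generic_vanish Q (r : {poly k}) :
  generic Q -> (forall e, Q e -> r.[e] = 0) -> r = 0.
Proof.
case=> s s0 sQ rQ; have /eqP : s * r = 0.
  apply: closed_field_infinite => e; rewrite hornerM.
  by have [->|/sQ/rQ->] := eqVneq s.[e] 0; rewrite (mul0r, mulr0).
by rewrite mulf_eq0 (negPf s0) => /eqP.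
Qed.

(** Evaluation of polynomials in one, two and three variables. *)
Definition ev1 (e : k) : {rmorphism {poly k} -> k} := horner_eval e.
Definition ev2 (e z : k) := spec (ev1 e) z.
Definition ev3 (e z z' : k) := spec (ev2 e z) z'.

(** For two families of monic polynomials in one parameter, the pairs of roots
    over a special parameter are limits of pairs of roots over generic ones. *)
Lemma monic_pairs_dense Q (f f' : {poly {poly k}}) (g : {poly {poly {poly k}}}) :
  generic Q -> f \is monic -> f' \is monic ->
  (forall e z z', Q e -> ev2 e z f = 0 -> ev2 e z' f' = 0 -> ev3 e z z' g = 0) ->
  forall e z z', ev2 e z f = 0 -> ev2 e z' f' = 0 -> ev3 e z z' g = 0.
Proof.
move=> gQ mf mf' Qg e z z' fz f'z'.
pose ev (u : k * k) := ev2 u.1 u.2.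
have mf'' : map_poly polyC f' \is monic by apply: monic_map.
have f''E e1 z1 z2 : ev3 e1 z1 z2 (map_poly polyC f') = ev2 e1 z2 f'.
  rewrite /ev3 /ev2 !specE -map_poly_comp; congr (_.[_]).
  by apply: eq_map_poly => p; apply: specC.
apply: (@monic_roots_dense _ _ _ ev (fun u => Q u.1 /\ ev2 u.1 u.2 f = 0)
  (fun u => ev2 u.1 u.2 f = 0) _ mf'' _ g _ (e, z) z') => //.
- move=> r Qr [e1 z1] /= fz1.
  apply: (@monic_roots_dense _ _ _ ev1 Q (fun=> True) _ mf _ r _ e1 z1) => //.
    by move=> p Qp e2 _; rewrite (generic_vanish gQ Qp) rmorph0.
  by move=> e2 z2 Qe2 fz2; apply: (Qr (e2, z2)).
- by move=> [e1 z1] z2 [Qe1 fz1] /=; rewrite [X in X = 0]f''E; apply: Qg.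
- by rewrite [LHS]f''E.
Qed.

End Generic.

(** * Symmetric functions of three coordinates *)

Notation o3 k := (inord k : 'I_3).

Section Forms.
Variable R : comNzRingType.
Implicit Types x : 'I_3 -> R.

(** The elementary symmetric functions [lin], [quad], [prod3] and the form
    (X + Y)(Y + Z)(Z + X) of Beauville's pencil. *)
Definition lin x : R := x (o3 0) + x (o3 1) + x (o3 2).
Definition quad x : R :=
  x (o3 0) * x (o3 1) + x (o3 1) * x (o3 2) + x (o3 2) * x (o3 0).
Definition prod3 x : R := x (o3 0) * x (o3 1) * x (o3 2).
Definition sums3 x : R :=
  (x (o3 0) + x (o3 1)) * (x (o3 1) + x (o3 2)) * (x (o3 2) + x (o3 0)).

Lemma sums3E x : sums3 x = lin x * quad x - prod3 x.
Proof. by rewrite /sums3 /lin /quad /prod3; ring. Qed.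

Lemma big_ord3 S (idx : S) (op : Monoid.law idx) (F : 'I_3 -> S) (Q : pred 'I_3) :
  \big[op/idx]_(i < 3 | Q i) F i =
  op (if Q (o3 0) then F (o3 0) else idx)
    (op (if Q (o3 1) then F (o3 1) else idx)
      (if Q (o3 2) then F (o3 2) else idx)).
Proof.
have [E0 E1 E2] : [/\ ord0 = o3 0, lift ord0 ord0 = o3 1
    & lift ord0 (lift ord0 ord0) = o3 2].
  by split; apply: val_inj; rewrite /= inordK.
by rewrite big_mkcond !big_ord_recl big_ord0 Monoid.mulm1 E2 E1 E0.
Qed.

Lemma sum3E x : \sum_(i < 3) x i = lin x.
Proof. by rewrite big_ord3 /= addrA. Qed.

Lemma prod3E x : \prod_(i < 3) x i = prod3 x.
Proof. by rewrite big_ord3 /= mulrA. Qed.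

Lemma quadE x : \sum_(j < 3) \prod_(i < 3 | i != j) x i = quad x.
Proof.
rewrite big_ord3 /= !big_ord3 -!val_eqE /= !inordK //= !mul1r !mulr1 /quad.
by ring.
Qed.

End Forms.

(** The triple with coordinates [a], [b], [c]; the default value of [nth] is
    never used. *)
Definition vec3 (R : Type) (a b c : R) : 'I_3 -> R := fun i => nth a [:: a; b; c] i.

Lemma vec3E (R : Type) (a b c : R) : 
  (vec3 a b c (o3 0) = a) * (vec3 a b c (o3 1) = b) * (vec3 a b c (o3 2) = c).
Proof. by rewrite /vec3 !inordK. Qed.

Section FormsHomog.
Variables (P : multiproj) (f : 'I_3 -> {mpoly rat[ncoord P]}).
Variable d : 'I_(nfactor P) -> nat.
Hypothesis hf : forall i, multihomog (f i) d.

Lemma lin_homog : multihomog (lin f) d.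
Proof. by apply: multihomogD => //; apply: multihomogD. Qed.

Lemma prod3_homog : multihomog (prod3 f) (fun j => d j + d j + d j)%N.
Proof. by apply: multihomogM => //; apply: multihomogM. Qed.

Lemma sums3_homog : multihomog (sums3 f) (fun j => d j + d j + d j)%N.
Proof. by do 2?apply: multihomogM; apply: multihomogD. Qed.

End FormsHomog.

Lemma evalQ_lin n (f : 'I_3 -> {mpoly rat[n]}) x :
  evalQ (lin f) x = lin (fun i => evalQ (f i) x).
Proof. by rewrite /lin !evalQE. Qed.

Lemma evalQ_prod3 n (f : 'I_3 -> {mpoly rat[n]}) x :
  evalQ (prod3 f) x = prod3 (fun i => evalQ (f i) x).
Proof. by rewrite /prod3 !evalQE. Qed.

Lemma evalQ_sums3 n (f : 'I_3 -> {mpoly rat[n]}) x :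
  evalQ (sums3 f) x = sums3 (fun i => evalQ (f i) x).
Proof. by rewrite /sums3 !evalQE. Qed.

(** Maps given by the same polynomials at all points. *)
Lemma regular_poly (P Q : multiproj) (A : pset P) (B : pset Q)
    (f : 'I_(ncoord Q) -> {mpoly rat[ncoord P]}) e :
  (forall i, multihomog (f i) (e (factor_of i))) ->
  (forall x, B x -> is_point x) ->
  (forall x, A x -> B (fun i => evalQ (f i) x)) ->
  regular_map A B (fun x i => evalQ (f i) x).
Proof.
move=> hf Bp AB; split=> // x Ax; exists f, e; split=> //; first by auto.
by move=> y _ _; apply: same_point_refl.
Qed.

(** * The two sides of the birational map *)

Notation pencil2_space := (prodsp (prodsp (projsp 2) (projsp 1)) (projsp 2)).

(** The coordinates of a point (p, t, q) of P_2 x P_1 x P_2, and the two halves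
    of a point of P_5. *)
Definition ptp (z : vec pencil2_space) : 'I_3 -> algC := fstv (fstv z).
Definition ptt (z : vec pencil2_space) : 'I_2 -> algC := sndv (fstv z).
Definition ptq (z : vec pencil2_space) : 'I_3 -> algC := sndv z.
Definition half1 (x : vec (projsp 5)) : 'I_3 -> algC :=
  fun i => x (lshift 3 i : 'I_(3 + 3)).
Definition half2 (x : vec (projsp 5)) : 'I_3 -> algC :=
  fun i => x (rshift 3 i : 'I_(3 + 3)).

Notation o2 k := (inord k : 'I_2).

(** The corresponding coordinate polynomials and their multidegrees. *)
Definition polyp (i : 'I_3) : {mpoly rat[ncoord pencil2_space]} :=
  'X_(lshift 3 (lshift 2 i)).
Definition polyt (i : 'I_2) : {mpoly rat[ncoord pencil2_space]} :=
  'X_(lshift 3 (rshift 3 i)).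
Definition polyq (i : 'I_3) : {mpoly rat[ncoord pencil2_space]} :=
  'X_(rshift (3 + 2) i).
Definition polyh1 (i : 'I_3) : {mpoly rat[ncoord (projsp 5)]} :=
  'X_(lshift 3 i : 'I_(3 + 3)).
Definition polyh2 (i : 'I_3) : {mpoly rat[ncoord (projsp 5)]} :=
  'X_(rshift 3 i : 'I_(3 + 3)).

Lemma polypE z i : evalQ (polyp i) z = ptp z i. Proof. exact: evalQX. Qed.
Lemma polytE z i : evalQ (polyt i) z = ptt z i. Proof. exact: evalQX. Qed.
Lemma polyqE z i : evalQ (polyq i) z = ptq z i. Proof. exact: evalQX. Qed.
Lemma polyh1E x i : evalQ (polyh1 i) x = half1 x i. Proof. exact: evalQX. Qed.
Lemma polyh2E x i : evalQ (polyh2 i) x = half2 x i. Proof. exact: evalQX. Qed.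

Definition degp (j : 'I_(nfactor pencil2_space)) : nat :=
  ((lshift 1 (lshift 1 ord0) : 'I_(1 + 1 + 1)) == j).
Definition degt (j : 'I_(nfactor pencil2_space)) : nat :=
  ((lshift 1 (rshift 1 ord0) : 'I_(1 + 1 + 1)) == j).
Definition degq (j : 'I_(nfactor pencil2_space)) : nat :=
  ((rshift (1 + 1) ord0 : 'I_(1 + 1 + 1)) == j).

Lemma polyp_homog i : @multihomog pencil2_space (polyp i) degp.
Proof.
apply: (@multihomog_eq pencil2_space _ _ _ _ (@multihomogX pencil2_space _)).
by move=> j; rewrite !factor_lshift.
Qed.

Lemma polyt_homog i : @multihomog pencil2_space (polyt i) degt.
Proof.
apply: (@multihomog_eq pencil2_space _ _ _ _ (@multihomogX pencil2_space _)).
by move=> j; rewrite factor_lshift factor_rshift.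
Qed.

Lemma polyq_homog i : @multihomog pencil2_space (polyq i) degq.
Proof.
apply: (@multihomog_eq pencil2_space _ _ _ _ (@multihomogX pencil2_space _)).
by move=> j; rewrite factor_rshift.
Qed.

Lemma polyh1_homog i : @multihomog (projsp 5) (polyh1 i) (fun=> 1%N).
Proof.
apply: (@multihomog_eq (projsp 5) _ _ _ _ (@multihomogX (projsp 5) _)).
by move=> j; rewrite !ord1.
Qed.

Lemma polyh2_homog i : @multihomog (projsp 5) (polyh2 i) (fun=> 1%N).
Proof.
apply: (@multihomog_eq (projsp 5) _ _ _ _ (@multihomogX (projsp 5) _)).
by move=> j; rewrite !ord1.
Qed.

(** The member of Beauville's pencil with parameter [t], evaluated at [x]. *)
Definition member (t : 'I_2 -> algC) (x : 'I_3 -> algC) : algC :=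
  t (o2 1) * sums3 x + t (o2 0) * prod3 x.

Lemma S16_fibre_squareE z : S16_fibre_square z <->
  [/\ is_point z, member (ptt z) (ptp z) = 0 & member (ptt z) (ptq z) = 0].
Proof.
rewrite /S16_fibre_square /fibre_square /beauville_pencil fstv_pair sndv_pair.
split=> [[[p1 E1] [p2 E2]]|[pz E1 E2]].
  split; [|exact: E1|exact: E2].
  apply/is_point_prod; split=> //.
  by have /is_point_prod := p2; rewrite fstv_pair sndv_pair => -[].
have /is_point_prod[p1 p2] := pz; split; split=> //.
apply/is_point_prod; rewrite fstv_pair sndv_pair; split=> //.
by have /is_point_prod[] := p1.
Qed.

Lemma sum_halves x : \sum_(i < 6) x i = lin (half1 x) + lin (half2 x).
Proof. by rewrite (@big_split_ord _ _ _ 3 3) -!sum3E. Qed.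

Lemma prod_halves x : \prod_(i < 6) x i = prod3 (half1 x) * prod3 (half2 x).
Proof. by rewrite (@big_split_ord _ _ _ 3 3) -!prod3E. Qed.

Lemma quintic_halves x : \sum_(j < 6) \prod_(i < 6 | i != j) x i =
  quad (half1 x) * prod3 (half2 x) + prod3 (half1 x) * quad (half2 x).
Proof.
rewrite (@big_split_ord _ _ _ 3 3) -!quadE -!prod3E mulr_suml mulr_sumr.
congr (_ + _); apply: eq_bigr => j _; rewrite (@big_split_ord _ _ _ 3 3).
  by congr (_ * _); apply: eq_bigl => i; rewrite (@eq_rlshift 3 3).
by congr (_ * _); apply: eq_bigl => i; rewrite (@eq_lrshift 3 3).
Qed.

(** The open part of the fibre square over the parameters t other than
    0, infinity, -8 and 1, outside the base points of the pencil. *)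
Definition square_bad : {mpoly rat[ncoord pencil2_space]} :=
  polyt (o2 0) * polyt (o2 1) * (polyt (o2 0) + polyt (o2 1) *+ 8)
  * (polyt (o2 0) - polyt (o2 1)) * prod3 polyp * prod3 polyq.

Definition square_open : pset pencil2_space := fun z =>
  S16_fibre_square z /\ evalQ square_bad z != 0.

Lemma square_bad_homog : exists d, @multihomog pencil2_space square_bad d.
Proof.
have ht := polyt_homog; eexists.
apply: multihomogM; last exact: prod3_homog polyq_homog.
apply: multihomogM; last exact: prod3_homog polyp_homog.
apply: multihomogM; last by apply: multihomogB; apply: ht.
apply: multihomogM; first by apply: multihomogM; apply: ht.
by apply: multihomogD; [|apply: multihomogMn]; apply: ht.
Qed.

Lemma square_badP z : evalQ square_bad z != 0 <->
  [/\ ptt z (o2 0) != 0, ptt z (o2 1) != 0,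
      ptt z (o2 0) + ptt z (o2 1) *+ 8 != 0, ptt z (o2 0) - ptt z (o2 1) != 0
    & (prod3 (ptp z) != 0) && (prod3 (ptq z) != 0)].
Proof.
rewrite evalQM (evalQ_prod3 polyq) evalQM (evalQ_prod3 polyp) !evalQM.
rewrite evalQB evalQD evalQMn !polytE.
have -> : prod3 (fun i => evalQ (polyp i) z) = prod3 (ptp z).
  by rewrite /prod3 !polypE.
have -> : prod3 (fun i => evalQ (polyq i) z) = prod3 (ptq z).
  by rewrite /prod3 !polyqE.
rewrite !mulf_eq0 !negb_or -!andbA.
by split=> [/and5P[-> -> -> -> ->]|[-> -> -> -> ->]].
Qed.

(** The corresponding open part of the quintic; it avoids the Segre points,
    where t = 0 or t = -8. *)
Definition quintic_bad : {mpoly rat[ncoord (projsp 5)]} :=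
  prod3 polyh1 * prod3 polyh2 * sums3 polyh1
  * (prod3 polyh1 *+ 8 - sums3 polyh1) * (prod3 polyh1 + sums3 polyh1).

Definition quintic_open : pset (projsp 5) := fun x =>
  barth_nieto_quintic x /\ evalQ quintic_bad x != 0.

Lemma quintic_bad_homog : exists d, @multihomog (projsp 5) quintic_bad d.
Proof.
have h1 := prod3_homog polyh1_homog; have h2 := prod3_homog polyh2_homog.
have hs := sums3_homog polyh1_homog.
eexists.
apply: multihomogM; last by apply: multihomogD; [exact: h1 | exact: hs].
apply: multihomogM; last by apply: multihomogB; [apply: multihomogMn|exact: hs].
apply: multihomogM; last exact: hs.
by apply: multihomogM; [exact: h1 | exact: h2].
Qed.

Lemma quintic_badP x : evalQ quintic_bad x != 0 <->
  [/\ prod3 (half1 x) != 0, prod3 (half2 x) != 0, sums3 (half1 x) != 0,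
      prod3 (half1 x) *+ 8 - sums3 (half1 x) != 0
    & prod3 (half1 x) + sums3 (half1 x) != 0].
Proof.
rewrite 2!evalQM evalQB evalQMn evalQD (evalQM _ _ (sums3 _)) evalQM.
rewrite !(evalQ_prod3 polyh1) (evalQ_prod3 polyh2) !evalQ_sums3.
have -> : prod3 (fun i => evalQ (polyh1 i) x) = prod3 (half1 x).
  by rewrite /prod3 !polyh1E.
have -> : prod3 (fun i => evalQ (polyh2 i) x) = prod3 (half2 x).
  by rewrite /prod3 !polyh2E.
have -> : sums3 (fun i => evalQ (polyh1 i) x) = sums3 (half1 x).
  by rewrite /sums3 !polyh1E.
move: (prod3 (half1 x)) (prod3 (half2 x)) (sums3 (half1 x)) => a b c.
rewrite !mulf_eq0 !negb_or -!andbA.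
by split=> [/and5P[-> -> -> -> ->]|[-> -> -> -> ->]].
Qed.

Lemma quintic_bad_coord_prod x :
  evalQ quintic_bad x != 0 -> evalQ coord_prod x != 0.
Proof.
by case/quintic_badP => h1 h2 _ _ _; rewrite coord_prodE prod_halves mulf_neq0.
Qed.

(** (p, t, q) is sent to (p lin(q), - q lin(p)), where both halves have opposite
    sums and opposite sums of inverses. *)
Definition to_quintic (i : 'I_(ncoord (projsp 5))) :
    {mpoly rat[ncoord pencil2_space]} :=
  match split (i : 'I_(3 + 3)) with
  | inl k => polyp k * lin polyq
  | inr k => - (polyq k * lin polyp)
  end.

(** Conversely (p, q) is sent to (p, t, q), where t is the parameter of the
    member of the pencil through p. *)
Definition to_square (i : 'I_(ncoord pencil2_space)) :
    {mpoly rat[ncoord (projsp 5)]} :=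
  match split (i : 'I_((3 + 2) + 3)) with
  | inl k => match split k with
             | inl k1 => polyh1 k1
             | inr k2 => if k2 == o2 0 then - sums3 polyh1 else prod3 polyh1
             end
  | inr k => polyh2 k
  end.

Definition to_quintic_pt (z : vec pencil2_space) : vec (projsp 5) :=
  fun i => evalQ (to_quintic i) z.

Definition to_square_pt (x : vec (projsp 5)) : vec pencil2_space :=
  fun i => evalQ (to_square i) x.

Lemma half1_to_quintic z i : half1 (to_quintic_pt z) i = ptp z i * lin (ptq z).
Proof.
rewrite /half1 /to_quintic_pt /to_quintic split_lshift evalQM polypE evalQ_lin.
by rewrite /lin !polyqE.
Qed.

Lemma half2_to_quintic z i :
  half2 (to_quintic_pt z) i = - (ptq z i * lin (ptp z)).
Proof.
rewrite /half2 /to_quintic_pt /to_quintic split_rshift evalQN evalQM polyqE.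
by rewrite evalQ_lin /lin !polypE.
Qed.

Lemma ptp_to_square x i : ptp (to_square_pt x) i = half1 x i.
Proof.
by rewrite /ptp /fstv /to_square_pt /to_square !split_lshift polyh1E.
Qed.

Lemma ptq_to_square x i : ptq (to_square_pt x) i = half2 x i.
Proof. by rewrite /ptq /sndv /to_square_pt /to_square split_rshift polyh2E. Qed.

Lemma ptt_to_square x i : ptt (to_square_pt x) i =
  if i == o2 0 then - sums3 (half1 x) else prod3 (half1 x).
Proof.
rewrite /ptt /fstv /sndv /to_square_pt /to_square split_lshift split_rshift.
case: ifP => _; first by rewrite evalQN evalQ_sums3 /sums3 !polyh1E.
by rewrite evalQ_prod3 /prod3 !polyh1E.
Qed.

Lemma o2_neq : (o2 1 == o2 0) = false.
Proof. by rewrite -val_eqE /= !inordK. Qed.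

Lemma ord2P (i : 'I_2) : i = o2 0 \/ i = o2 1.
Proof.
by case: i => -[|[|//]] h; [left | right]; apply: val_inj; rewrite /= inordK.
Qed.

Lemma is_point_square z : ptt z (o2 1) != 0 -> prod3 (ptp z) != 0 ->
  prod3 (ptq z) != 0 -> is_point z.
Proof.
move=> t1; rewrite /prod3 !mulf_eq0 !negb_or -!andbA => /andP[p0 _] /andP[q0 _].
apply/is_point_prod; split; last by move=> j; exists (o3 0); rewrite ?[j]ord1.
apply/is_point_prod; split=> j; rewrite [j]ord1.
  by exists (o3 0).
by exists (o2 1).
Qed.

Section FormsScale.
Variables (R : comNzRingType) (f g : 'I_3 -> R) (c : R).
Hypothesis fE : forall i, f i = c * g i.

Lemma lin_scale : lin f = c * lin g.
Proof. by rewrite /lin !fE; ring. Qed.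
Lemma quad_scale : quad f = c ^+ 2 * quad g.
Proof. by rewrite /quad !fE; ring. Qed.
Lemma prod3_scale : prod3 f = c ^+ 3 * prod3 g.
Proof. by rewrite /prod3 !fE; ring. Qed.
Lemma sums3_scale : sums3 f = c ^+ 3 * sums3 g.
Proof. by rewrite /sums3 !fE; ring. Qed.

End FormsScale.

(** Outside the parameter t = 1 and the base points, [lin] does not vanish on
    the members of the pencil. *)
Lemma lin_member_neq0 t x : t (o2 0) - t (o2 1) != 0 -> prod3 x != 0 ->
  member t x = 0 -> lin x != 0.
Proof.
move=> t01 b0; rewrite /member sums3E => E; apply/eqP => l0.
have : (t (o2 0) - t (o2 1)) * prod3 x = 0 by rewrite -E l0; ring.
by move/eqP; rewrite mulf_eq0 (negPf t01) (negPf b0).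
Qed.

Lemma is_point_quintic x : prod3 (half1 x) != 0 -> @is_point (projsp 5) x.
Proof.
rewrite /prod3 !mulf_eq0 !negb_or -!andbA => /andP[x0 _] j.
by exists (lshift 3 (o3 0) : 'I_(3 + 3)); rewrite ?[j]ord1 ?[LHS]ord1.
Qed.

Lemma barth_nieto_quinticE x : barth_nieto_quintic x <->
  [/\ @is_point (projsp 5) x, lin (half1 x) + lin (half2 x) = 0 &
    quad (half1 x) * prod3 (half2 x) + prod3 (half1 x) * quad (half2 x) = 0].
Proof.
rewrite /barth_nieto_quintic /P0 sum_halves quintic_halves.
by split=> [[[]]|[]].
Qed.

Lemma to_quintic_open z : square_open z -> quintic_open (to_quintic_pt z).
Proof.
case=> /S16_fibre_squareE[pz mp mq] /square_badP[t0 t1 t8 t01 /andP[bp bq]].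
have lp := lin_member_neq0 t01 bp mp; have lq := lin_member_neq0 t01 bq mq.
have h1 i : half1 (to_quintic_pt z) i = lin (ptq z) * ptp z i.
  by rewrite half1_to_quintic mulrC.
have h2 i : half2 (to_quintic_pt z) i = - lin (ptp z) * ptq z i.
  by rewrite half2_to_quintic mulrC mulNr.
have b1 : prod3 (half1 (to_quintic_pt z)) != 0.
  by rewrite (prod3_scale h1) mulf_neq0 ?expf_neq0.
split; last (apply/quintic_badP; split => //).
- apply/barth_nieto_quinticE; split; first exact: is_point_quintic.
    by rewrite (lin_scale h1) (lin_scale h2); ring.
  rewrite (prod3_scale h1) (prod3_scale h2) (quad_scale h1) (quad_scale h2).
  apply: (mulfI t1); rewrite mulr0.
  move: mp mq; rewrite /member !sums3E => mp mq.
  transitivity (lin (ptp z) ^+ 2 * lin (ptq z) ^+ 2 *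
    ((ptt z (o2 1) * (lin (ptq z) * quad (ptq z) - prod3 (ptq z))
        + ptt z (o2 0) * prod3 (ptq z)) * prod3 (ptp z)
     - (ptt z (o2 1) * (lin (ptp z) * quad (ptp z) - prod3 (ptp z))
        + ptt z (o2 0) * prod3 (ptp z)) * prod3 (ptq z))); first by ring.
  by rewrite mp mq; ring.
- by rewrite (prod3_scale h2) mulf_neq0 ?expf_neq0 ?oppr_eq0.
- rewrite (sums3_scale h1) mulf_neq0 ?expf_neq0 //; apply/eqP => s0.
  move/eqP: mp; rewrite /member s0 mulr0 add0r mulf_eq0.
  by rewrite (negPf t0) (negPf bp).
- rewrite (sums3_scale h1) (prod3_scale h1) -mulrnAr -mulrBr.
  rewrite mulf_neq0 ?expf_neq0 //; apply/eqP => s0.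
  have : (ptt z (o2 0) + ptt z (o2 1) *+ 8) * prod3 (ptp z) = 0.
    transitivity (ptt z (o2 1) * (prod3 (ptp z) *+ 8 - sums3 (ptp z))
      + member (ptt z) (ptp z)); first by rewrite /member; ring.
    by rewrite s0 mp; ring.
  by move/eqP; rewrite mulf_eq0 (negPf t8) (negPf bp).
- rewrite (sums3_scale h1) (prod3_scale h1) -mulrDr mulf_neq0 ?expf_neq0 //.
  apply/eqP => s0.
  have : (ptt z (o2 0) - ptt z (o2 1)) * prod3 (ptp z) = 0.
    transitivity (member (ptt z) (ptp z)
      - ptt z (o2 1) * (prod3 (ptp z) + sums3 (ptp z))).
      by rewrite /member; ring.
    by rewrite s0 mp; ring.
  by move/eqP; rewrite mulf_eq0 (negPf t01) (negPf bp).
Qed.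

Lemma eq_forms (R : comNzRingType) (x y : 'I_3 -> R) : x =1 y ->
  [/\ lin x = lin y, quad x = quad y, prod3 x = prod3 y & sums3 x = sums3 y].
Proof. by move=> xy; rewrite /lin /quad /prod3 /sums3 !xy. Qed.

Lemma to_square_open x : quintic_open x -> square_open (to_square_pt x).
Proof.
case=> /barth_nieto_quinticE[px sx qx] /quintic_badP[b1 b2 s1 s8 s01].
have [Lp _ Bp Sp] := eq_forms (ptp_to_square x).
have [Lq _ Bq Sq] := eq_forms (ptq_to_square x).
have T0 : ptt (to_square_pt x) (o2 0) = - sums3 (half1 x).
  by rewrite ptt_to_square eqxx.
have T1 : ptt (to_square_pt x) (o2 1) = prod3 (half1 x).
  by rewrite ptt_to_square o2_neq.
have E2 : lin (half2 x) = - lin (half1 x).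
  by apply/eqP; rewrite -addr_eq0 addrC sx.
split; last first.
  apply/square_badP; rewrite T0 T1 Bp Bq oppr_eq0 b1 b2 s1; split=> //.
    by rewrite addrC.
  by rewrite -opprD oppr_eq0 addrC.
apply/S16_fibre_squareE; split; rewrite /member ?T0 ?T1 ?Bp ?Bq ?Sp ?Sq.
- by apply: is_point_square; rewrite ?T1 ?Bp ?Bq.
- by ring.
- rewrite !sums3E E2; transitivity (- lin (half1 x) *
    (quad (half1 x) * prod3 (half2 x) + prod3 (half1 x) * quad (half2 x))).
    by ring.
  by rewrite qx mulr0.
Qed.

Lemma to_quintic_homog i : @multihomog pencil2_space (to_quintic i)
  (fun j => degp j + degq j)%N.
Proof.
rewrite /to_quintic; case: (split _) => k.
  exact: multihomogM (@polyp_homog k) (lin_homog polyq_homog).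
apply: multihomogN; apply: multihomog_eq
  (multihomogM (@polyq_homog k) (lin_homog polyp_homog)) => j.
exact: addnC.
Qed.

Definition deg_to_square (j : 'I_(nfactor pencil2_space)) :
    'I_(nfactor (projsp 5)) -> nat := fun=>
  match split (j : 'I_((1 + 1) + 1)) with
  | inl k => if split k is inl _ then 1 else 1 + 1 + 1
  | inr _ => 1
  end%N.

Lemma to_square_homog i :
  @multihomog (projsp 5) (to_square i) (deg_to_square (factor_of i)).
Proof.
have hs := sums3_homog polyh1_homog; have hb := prod3_homog polyh1_homog.
rewrite -[i]splitK /to_square /deg_to_square; case: (split i) => k.
  rewrite [unsplit _]/= factor_lshift !split_lshift.
  rewrite -[k]splitK; case: (split k) => k'.
    rewrite [unsplit _]/= factor_lshift !split_lshift; apply: polyh1_homog.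
  rewrite [unsplit _]/= factor_rshift !split_rshift.
  by case: ifP => _; [apply: multihomogN; exact: hs | exact: hb].
rewrite [unsplit _]/= factor_rshift !split_rshift; apply: polyh2_homog.
Qed.

(** The birational equivalence between the fibre square and the quintic. *)
Lemma square_quintic_isomorphic : isomorphic square_open quintic_open.
Proof.
exists to_quintic_pt, to_square_pt; split.
- apply: (regular_poly (e := fun=> fun j => (degp j + degq j)%N)).
  + exact: to_quintic_homog.
  + by move=> x [[[]]].
  + exact: to_quintic_open.
- apply: (regular_poly (e := deg_to_square)).
  + exact: to_square_homog.
  + by move=> z [/S16_fibre_squareE[]].
  + exact: to_square_open.
- move=> z Uz; have [/S16_fibre_squareE[pz mp mq]] := Uz.
  move=> /square_badP[t0 t1 t8 t01 /andP[bp bq]].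
  have lp := lin_member_neq0 t01 bp mp; have lq := lin_member_neq0 t01 bq mq.
  have h1 i : half1 (to_quintic_pt z) i = lin (ptq z) * ptp z i.
    by rewrite half1_to_quintic mulrC.
  apply/same_point_prod; split; first (apply/same_point_prod; split).
  + exists (fun=> lin (ptq z)) => // i.
    by rewrite -[LHS]/(ptp _ i) ptp_to_square h1.
  + exists (fun=> lin (ptq z) ^+ 3 * prod3 (ptp z) / ptt z (o2 1)) => [j|i].
      by rewrite mulf_neq0 ?invr_eq0 // mulf_neq0 ?expf_neq0.
    rewrite -[LHS]/(ptt _ i) ptt_to_square -/(ptt z i).
    rewrite (sums3_scale h1) (prod3_scale h1).
    have [->|->] := ord2P i; rewrite ?eqxx ?o2_neq; last by rewrite divfK.
    have -> : sums3 (ptp z) = - (ptt z (o2 0) * prod3 (ptp z)) / ptt z (o2 1).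
      apply: (mulIf t1); rewrite divfK //; apply/eqP; rewrite -addr_eq0.
      by rewrite mulrC -mp.
    by rewrite mulNr mulrN opprK; ring.
  + exists (fun=> - lin (ptp z)) => [j|i]; first by rewrite oppr_eq0.
    by rewrite -[LHS]/(ptq _ i) ptq_to_square half2_to_quintic mulNr mulrC.
- move=> x Nx; have [Uz] := to_square_open Nx.
  case: Nx => /barth_nieto_quinticE[px sx qx] /quintic_badP[b1 b2 s1 s8 s01] _.
  have [Lp _ Bp Sp] := eq_forms (ptp_to_square x).
  have [Lq _ Bq Sq] := eq_forms (ptq_to_square x).
  have E2 : lin (half2 x) = - lin (half1 x).
    by apply/eqP; rewrite -addr_eq0 addrC sx.
  exists (fun=> - lin (half1 x)) => [j|i].
    rewrite oppr_eq0; apply: contraNneq s01 => l0.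
    by rewrite sums3E l0; apply/eqP; ring.
  rewrite -[i](@splitK 3 3); case: (@split 3 3 i) => k.
    rewrite -[LHS]/(half1 _ k) half1_to_quintic ptp_to_square Lq E2.
    by rewrite mulrC.
  rewrite -[LHS]/(half2 _ k) half2_to_quintic ptq_to_square Lp mulNr.
  by rewrite mulrC.
Qed.

(** * Density in the fibre square *)

(** Substituting polynomials for the coordinates in a rational polynomial, in a
    way compatible with every specialization. *)
Lemma evalQ_lift n (S : comNzRingType) (c : {rmorphism rat -> S})
    (v : 'I_n -> S) (p : {mpoly rat[n]}) :
  exists G : S, forall phi : {rmorphism S -> algC},
    phi G = evalQ p (fun i => phi (v i)).
Proof.
exists (mmap c v p) => phi.
have := rmorph_evalQ (phi \o mmap c v) p; rewrite /= => ->.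
by apply: eq_evalQ => i; rewrite mmapX mmap1U.
Qed.

Section Pencil.
Variables (c2 : algC) (t u : 'I_2 -> algC).

(** The two coordinates of the projection of the plane from the point
    (1 : 1 : c2). *)
Definition center_proj1 (x : 'I_3 -> algC) := x (o3 0) - x (o3 1).
Definition center_proj2 (x : 'I_3 -> algC) := x (o3 2) - c2 * x (o3 0).

(** For both values 0 and -1 of [c2], the lines through (1 : 1 : c2) and the base
    points are among the five lines excluded here. *)
Definition off_base (x : 'I_3 -> algC) : Prop :=
  [/\ center_proj1 x != 0, center_proj2 x != 0, center_proj1 x - center_proj2 x != 0,
      center_proj1 x + center_proj2 x != 0 & center_proj1 x - center_proj2 x *+ 2 != 0].

(** The two centers of projection considered: each comes with a direction [u]
    in which the parameter moves so that the coefficient [pencil_lead] of the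
    cube of the coordinate along the lines through the center is constant. *)
Definition pencil_center : Prop :=
  [/\ c2 = 0, u (o2 0) = 1, u (o2 1) = 0 & t (o2 1) != 0] \/
  [/\ c2 = -1, u (o2 0) = 0, u (o2 1) = 1 & t (o2 0) != 0].

(** A point where both generators of the pencil vanish is a base point. *)
Lemma off_base_prod3 x :
  pencil_center -> off_base x -> sums3 x = 0 -> prod3 x != 0.
Proof.
move=> hc [a0 b0 ab0 ab1 ab2] s0; apply/eqP => p0.
suff : center_proj1 x * center_proj2 x * (center_proj1 x - center_proj2 x)
    * (center_proj1 x + center_proj2 x) * (center_proj1 x - center_proj2 x *+ 2) = 0.
  by apply/eqP; rewrite !mulf_neq0.
move: s0 p0; rewrite /sums3 /prod3 /center_proj1 /center_proj2.
move: (x (o3 0)) (x (o3 1)) (x (o3 2)) => X Y Z.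
move/eqP; rewrite !mulf_eq0 !addr_eq0 => hs /eqP.
rewrite !mulf_eq0 => hp.
by case: hc => -[-> _ _ _]; case/orP: hp => [/orP[]|] /eqP hp;
  case/orP: hs => [/orP[]|] /eqP; rewrite hp => hs;
  rewrite ?hs; move: hs => /eqP; rewrite ?(eq_sym 0) ?oppr_eq0 => /eqP hs;
  rewrite ?hs; ring.
Qed.

(** The value at (1 : 1 : c2) of the member with parameter [t]. *)
Definition pencil_lead : algC := 2 * t (o2 1) * (1 + c2) ^+ 2 + t (o2 0) * c2.

Lemma pencil_lead_neq0 : pencil_center -> pencil_lead != 0.
Proof.
rewrite /pencil_lead; case=> -[-> _ _ t0].
  by rewrite addr0 expr1n mulr1 mulr0 addr0 mulf_neq0 ?Num.Theory.pnatr_eq0.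
by rewrite subrr expr0n mulr0 add0r mulrN1 oppr_eq0.
Qed.

(** The parameter moves along [u], and the point x moves along (3, 0, 1), a
    direction in which all the linear forms of [off_base] vary. *)
Definition moving_t (i : 'I_2) : {poly algC} := (t i)%:P + 'X * (u i)%:P.
Definition moving_dir : 'I_3 -> algC := vec3 3 0 1.
Definition moving_pt (x : 'I_3 -> algC) (i : 'I_3) : {poly algC} :=
  (x i)%:P + 'X * (moving_dir i)%:P.

(** The moving parameter, and the point of coordinate [z] on the line through
    the center and the moving point, at the time [e]. *)
Definition line_pt (x : 'I_3 -> algC) (e z : algC) (i : 'I_3) : algC :=
  x i + e * moving_dir i + z * vec3 1 1 c2 i.
Definition line_t (e : algC) (i : 'I_2) : algC := t i + e * u i.

(** The equation of the moving member along this line, divided by its leading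
    coefficient: a cubic in [z] with coefficients polynomial in [e]. *)
Definition line_cubic (x : 'I_3 -> algC) : {poly {poly algC}} :=
  let T0 := moving_t (o2 0) in let T1 := moving_t (o2 1) in
  let X := moving_pt x (o3 0) in let Y := moving_pt x (o3 1) in
  let Z := moving_pt x (o3 2) in let c := c2%:P in let l := pencil_lead^-1%:P in
  'X^3
  + (l * (T1 * ((X + Y) * (1 + c) ^+ 2 + 2 * (1 + c) * (Y + Z + (Z + X)))
          + T0 * (c * (X + Y) + Z)))%:P * 'X^2
  + (l * (T1 * ((X + Y) * (1 + c) * (Y + Z + (Z + X)) + 2 * (Y + Z) * (Z + X))
          + T0 * (c * X * Y + (X + Y) * Z)))%:P * 'X
  + (l * (T1 * ((X + Y) * (Y + Z) * (Z + X)) + T0 * (X * Y * Z)))%:P.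

Lemma monic_cubic (R : nzRingType) (a b c : R) :
  'X^3 + a%:P * 'X^2 + b%:P * 'X + c%:P \is monic.
Proof.
have s : (size (a%:P * 'X^2 + b%:P * 'X + c%:P : {poly R})%R < 4)%N.
  rewrite (leq_ltn_trans (size_polyD _ _)) // gtn_max.
  rewrite (leq_ltn_trans (size_polyC_leq1 _)) // andbT.
  rewrite (leq_ltn_trans (size_polyD _ _)) // gtn_max !mul_polyC.
  rewrite (leq_ltn_trans (size_scale_leq _ _)) ?size_polyXn //.
  by rewrite (leq_ltn_trans (size_scale_leq _ _)) ?size_polyX.
by rewrite -!addrA addrA -!addrA monicE lead_coefDl ?size_polyXn ?addrA //
  lead_coefXn.
Qed.

Lemma ev1E e (a b : algC) : ev1 e (a%:P + 'X * b%:P) = a + e * b.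
Proof. by rewrite /ev1 /= /horner_eval !hornerE. Qed.

Lemma ev1X (e : algC) : ev1 e 'X = e.
Proof. by rewrite /ev1 /= /horner_eval hornerX. Qed.

Lemma line_cubicE x e z : pencil_center ->
  pencil_lead * ev2 e z (line_cubic x) = member (line_t e) (line_pt x e z).
Proof.
move=> hc; have l0 := pencil_lead_neq0 hc.
have evX : ev2 e z 'X = z by apply: specX.
have evC (p : {poly algC}) : ev2 e z p%:P = ev1 e p by apply: specC.
have ev1C a : ev1 e a%:P = a by rewrite /ev1 /= /horner_eval hornerC.
rewrite /line_cubic !(rmorphD, rmorphM, rmorphXn, rmorph1, rmorph_nat, evX, evC).
rewrite /moving_t /moving_pt.
rewrite !(ev1E, ev1C, ev1X, rmorphD, rmorphM, rmorphXn, rmorph1, rmorph_nat).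
rewrite /member /sums3 /prod3 /line_t /line_pt /moving_dir !vec3E.
move: l0; rewrite /pencil_lead.
by case: hc => -[-> -> -> t0] l0; field.
Qed.

Lemma off_base_generic x : pencil_center ->
  generic (fun e => forall z, off_base (line_pt x e z)).
Proof.
move=> hc.
have E1 e z : center_proj1 (line_pt x e z) = center_proj1 x + e * 3.
  by rewrite /center_proj1 /line_pt /moving_dir !vec3E; ring.
have E2 e z : center_proj2 (line_pt x e z) = center_proj2 x + e * (1 - c2 *+ 3).
  by rewrite /center_proj2 /line_pt /moving_dir !vec3E; ring.
(* The coefficients of e in the five linear forms are nonzero integers. *)
have nz (n : nat) (b : algC) : b = n.+1%:R -> forall a : algC, (a != 0) || (b != 0).
  by move=> -> a; rewrite Num.Theory.pnatr_eq0 orbT.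
have nzN (n : nat) (b : algC) : b = - n.+1%:R -> forall a : algC, (a != 0) || (b != 0).
  by move=> -> a; rewrite oppr_eq0 Num.Theory.pnatr_eq0 orbT.
have G1 : generic (fun e : algC => center_proj1 x + e * 3 != 0).
  by apply: generic_lin; apply: (nz 2%N).
have G2 : generic (fun e : algC => center_proj2 x + e * (1 - c2 *+ 3) != 0).
  apply: generic_lin; case: hc => -[-> _ _ _]; [apply: (nz 0%N) | apply: (nz 3%N)];
  by ring.
have G3 : generic (fun e : algC =>
    center_proj1 x - center_proj2 x + e * (3 - (1 - c2 *+ 3)) != 0).
  apply: generic_lin; case: hc => -[-> _ _ _]; [apply: (nz 1%N) | apply: (nzN 0%N)];
  by ring.
have G4 : generic (fun e : algC =>
    center_proj1 x + center_proj2 x + e * (3 + (1 - c2 *+ 3)) != 0).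
  apply: generic_lin; case: hc => -[-> _ _ _]; [apply: (nz 3%N) | apply: (nz 6%N)];
  by ring.
have G5 : generic (fun e : algC =>
    center_proj1 x - center_proj2 x *+ 2 + e * (3 - (1 - c2 *+ 3) *+ 2) != 0).
  apply: generic_lin; case: hc => -[-> _ _ _]; [apply: (nz 0%N) | apply: (nzN 4%N)];
  by ring.
apply: generic_impl (generic_and G1 (generic_and G2 (generic_and G3
  (generic_and G4 G5)))) _ => e [g1 [g2 [g3 [g4 g5]]]] z.
split; rewrite ?E1 ?E2 //.
- by move: g3; congr (_ != 0); ring.
- by move: g4; congr (_ != 0); ring.
- by move: g5; congr (_ != 0); ring.
Qed.

(** The parameters t = 0, infinity, -8 and 1 are left generically. *)
Definition good_t (T : 'I_2 -> algC) : Prop :=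
  [/\ T (o2 0) != 0, T (o2 1) != 0, T (o2 0) + T (o2 1) *+ 8 != 0
    & T (o2 0) - T (o2 1) != 0].

Lemma good_t_generic : pencil_center -> generic (fun e => good_t (line_t e)).
Proof.
move=> hc.
have G1 : generic (fun e : algC => t (o2 0) + e * u (o2 0) != 0).
  by apply: generic_lin; case: hc => -[_ -> _ h]; rewrite ?h ?oner_neq0 ?orbT.
have G2 : generic (fun e : algC => t (o2 1) + e * u (o2 1) != 0).
  by apply: generic_lin; case: hc => -[_ _ -> h]; rewrite ?h ?oner_neq0 ?orbT.
have G3 : generic (fun e : algC =>
    t (o2 0) + t (o2 1) *+ 8 + e * (u (o2 0) + u (o2 1) *+ 8) != 0).
  apply: generic_lin; case: hc => -[_ -> -> _].
    by rewrite mul0rn addr0 oner_neq0 orbT.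
  by rewrite add0r Num.Theory.pnatr_eq0 orbT.
have G4 : generic (fun e : algC =>
    t (o2 0) - t (o2 1) + e * (u (o2 0) - u (o2 1)) != 0).
  apply: generic_lin; case: hc => -[_ -> -> _].
    by rewrite subr0 oner_neq0 orbT.
  by rewrite add0r oppr_eq0 oner_neq0 orbT.
apply: generic_impl (generic_and G1 (generic_and G2 (generic_and G3 G4))) _.
move=> e [g1 [g2 [g3 g4]]]; split=> //; rewrite /line_t.
- by move: g3; congr (_ != 0); ring.
- by move: g4; congr (_ != 0); ring.
Qed.

End Pencil.

Lemma square_open_dense : dense_in square_open S16_fibre_square.
Proof.
move=> z0 /S16_fibre_squareE[pz0 mp mq]; split=> // p d hp pU.
pose t := ptt z0.
(* The center of projection is not on the member of parameter t. *)
have [c2 [u hc]] : exists c2 u, pencil_center c2 t u.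
  have /is_point_prod[/is_point_prod[_ pt] _] := pz0.
  have [i _ ti] := pt ord0.
  have [i0|i1] := ord2P i.
    exists (-1), (fun i => if i == o2 0 then 0 else 1); right.
    by rewrite eqxx o2_neq -i0.
  exists 0, (fun i => if i == o2 0 then 1 else 0); left.
  by rewrite eqxx o2_neq -i1.
pose mk (a : 'I_3 -> algC) (b : 'I_2 -> algC) (c : 'I_3 -> algC) :
    vec pencil2_space :=
  @pairv (prodsp (projsp 2) (projsp 1)) (projsp 2)
    (@pairv (projsp 2) (projsp 1) a b) c.
have mkp a b c : ptp (mk a b c) = a by rewrite /ptp /mk !fstv_pair.
have mkt a b c : ptt (mk a b c) = b by rewrite /ptt /mk fstv_pair sndv_pair.
have mkq a b c : ptq (mk a b c) = c by rewrite /ptq /mk sndv_pair.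
pose dir := mk moving_dir u moving_dir.
pose cp := mk (vec3 1 1 c2) (fun=> 0) (fun=> 0).
pose cq := mk (fun=> 0) (fun=> 0) (vec3 1 1 c2).
pose moved (e z z' : algC) : vec pencil2_space :=
  fun i => z0 i + e * dir i + z * cp i + z' * cq i.
have movedp e z z' i : ptp (moved e z z') i = line_pt c2 (ptp z0) e z i.
  rewrite -[LHS]/(ptp z0 i + e * ptp dir i + z * ptp cp i + z' * ptp cq i).
  by rewrite /dir /cp /cq !mkp mulr0 addr0.
have movedq e z z' i : ptq (moved e z z') i = line_pt c2 (ptq z0) e z' i.
  rewrite -[LHS]/(ptq z0 i + e * ptq dir i + z * ptq cp i + z' * ptq cq i).
  by rewrite /dir /cp /cq !mkq mulr0 addr0.
have movedt e z z' i : ptt (moved e z z') i = line_t t u e i.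
  rewrite -[LHS]/(ptt z0 i + e * ptt dir i + z * ptt cp i + z' * ptt cq i).
  by rewrite /dir /cp /cq !mkt !mulr0 !addr0.
(* The coordinates of the moving point as polynomials in e, z and z'. *)
pose c (a : algC) : {poly {poly {poly algC}}} := a%:P%:P%:P.
pose v i := c (z0 i) + 'X%:P%:P * c (dir i) + 'X%:P * c (cp i) + 'X * c (cq i).
have evv e z z' i : ev3 e z z' (v i) = moved e z z' i.
  have evc a : ev3 e z z' (c a) = a.
    by rewrite /ev3 specC /ev2 specC /ev1 /= /horner_eval hornerC.
  have ev_e : ev3 e z z' 'X%:P%:P = e by rewrite /ev3 specC /ev2 specC ev1X.
  have ev_z : ev3 e z z' 'X%:P = z by rewrite /ev3 specC /ev2 specX.
  have ev_z' : ev3 e z z' 'X = z' by rewrite /ev3 specX.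
  by rewrite !(rmorphD, rmorphM) !evc ev_e ev_z ev_z'.
have [G GE] := evalQ_lift
  (polyC \o polyC \o polyC \o (ratr : rat -> algC)) v p.
have G0 e z z' : ev3 e z z' G = evalQ p (moved e z z').
  by rewrite GE; apply: eq_evalQ => i; apply: evv.
have l0 := pencil_lead_neq0 hc.
pose Q (e : algC) := (good_t (line_t t u e) /\
  ((forall z, off_base c2 (line_pt c2 (ptp z0) e z)) /\
   (forall z, off_base c2 (line_pt c2 (ptq z0) e z))))%type.
have gQ : generic Q.
  exact: (generic_and (good_t_generic hc)
    (generic_and (off_base_generic (ptp z0) hc) (off_base_generic (ptq z0) hc))).
have cubicP x e z : ev2 e z (line_cubic c2 t u x) = 0 <->
    member (line_t t u e) (line_pt c2 x e z) = 0.
  rewrite -(line_cubicE x e z hc); split=> [->|/eqP]; first by rewrite mulr0.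
  by rewrite mulf_eq0 (negPf l0) => /eqP.
have z00 : moved 0 0 0 =1 z0 by move=> i; rewrite /moved !mul0r !addr0.
have line0 x i : line_pt c2 x 0 0 i = x i by rewrite /line_pt !mul0r !addr0.
have linet0 i : line_t t u 0 i = t i by rewrite /line_t mul0r addr0.
rewrite -(eq_evalQ p z00) -G0.
apply: (monic_pairs_dense gQ (f := line_cubic c2 t u (ptp z0))
  (f' := line_cubic c2 t u (ptq z0))).
- exact: monic_cubic.
- exact: monic_cubic.
- move=> e z z' [gt [offp offq]] /cubicP fz /cubicP fz'; rewrite G0.
  have onE x : member (line_t t u e) x = 0 -> off_base c2 x -> prod3 x != 0.
    move=> mx ox; apply/negP => /eqP b0; move: mx; rewrite /member b0 mulr0 addr0.
    case: gt => _ t1 _ _ /eqP; rewrite mulf_eq0 (negPf t1) /= => /eqP s0.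
    by have := off_base_prod3 hc ox s0; rewrite b0 eqxx.
  have [_ _ Bp _] := eq_forms (movedp e z z').
  have [_ _ Bq _] := eq_forms (movedq e z z').
  have bp := onE _ fz (offp z); have bq := onE _ fz' (offq z').
  apply: pU; split; last first.
    by apply/square_badP; rewrite !movedt Bp Bq bp bq; case: gt.
  apply/S16_fibre_squareE; split.
  + by apply: is_point_square; rewrite ?movedt ?Bp ?Bq //; case: gt.
  + by move: fz; rewrite /member /sums3 /prod3 !movedp !movedt.
  + by move: fz'; rewrite /member /sums3 /prod3 !movedq !movedt.
- by apply/cubicP; move: mp; rewrite /member /sums3 /prod3 !line0 !linet0.
- by apply/cubicP; move: mq; rewrite /member /sums3 /prod3 !line0 !linet0.
Qed.

(** * The Calabi-Yau model *)

(** The point (1 : 2 : 3 : -1 : -2 : -3) of the quintic. *)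
Definition sample_point : vec (projsp 5) := fun i =>
  match split (i : 'I_(3 + 3)) with
  | inl k => k.+1%:R
  | inr k => - k.+1%:R
  end.

Lemma sample_point_open : quintic_open sample_point.
Proof.
have E1 i : half1 sample_point i = i.+1%:R.
  by rewrite /half1 /sample_point split_lshift.
have E2 i : half2 sample_point i = -1 * half1 sample_point i.
  by rewrite E1 /half2 /sample_point split_rshift mulN1r.
have L : lin (half1 sample_point) = 6 by rewrite /lin !E1 !inordK //; ring.
have B : prod3 (half1 sample_point) = 6 by rewrite /prod3 !E1 !inordK //; ring.
have S : sums3 (half1 sample_point) = 60 by rewrite /sums3 !E1 !inordK //; ring.
have nz (n : nat) : (n.+1%:R != 0 :> algC) by rewrite Num.Theory.pnatr_eq0.
have B0 : prod3 (half1 sample_point) != 0 by rewrite B nz.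
split.
  apply/barth_nieto_quinticE; split; first exact: is_point_quintic.
    by rewrite (lin_scale E2); ring.
  by rewrite (prod3_scale E2) (quad_scale E2); ring.
apply/quintic_badP; rewrite (prod3_scale E2) B S; split; rewrite ?nz //.
- by rewrite mulf_neq0 ?expf_neq0 ?oppr_eq0 ?oner_neq0 ?nz.
- by rewrite (_ : _ - _ = - 12%:R) ?oppr_eq0 ?nz //; ring.
- by rewrite (_ : _ + _ = 66%:R) ?nz //; ring.
Qed.

(** The Segre points lie over t = 0, where two of the first three coordinates
    are opposite, or over t = -8, where all three are equal. *)
Lemma segre_quintic_bad x : segre_point x -> evalQ quintic_bad x = 0.
Proof.
case=> S _ xS; have [d hd] := quintic_bad_homog.
apply: same_point_zero hd xS _; apply/eqP/negP => /negP/quintic_badP[_ _].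
rewrite /sums3 /prod3 /half1.
(* Whatever the three signs, one of the two factors vanishes. *)
by do 3!case: ifP => _; move=> /eqP s0 /eqP s8 _;
  (apply: s0; ring) || (apply: s8; ring).
Qed.

Section Model.
Variables (P : multiproj) (Y : pset P) (T : barth_nieto_tower).
Variable pi : vec P -> vec (N3_space T).
Hypothesis hpi : small_resolution Y (@N3 T) (@N3_segre T) pi.

(** The pullback of [quintic_bad] to the total space of the tower. *)
Definition tower_bad : {mpoly rat[ncoord (N3_space T)]} :=
  pull_fst (projsp (ce_size (bnt3 T))) (pull_fst (projsp (ce_size (bnt2 T)))
    (pull_fst (projsp (ce_size (bnt1 T))) quintic_bad)).

Lemma tower_badE z : evalQ tower_bad z = evalQ quintic_bad (tower_base (T := T) z).
Proof. by rewrite !evalQ_pull_fst. Qed.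

Lemma tower_bad_homog : exists d, @multihomog (N3_space T) tower_bad d.
Proof.
have [d hd] := quintic_bad_homog; eexists.
by do 3!apply: multihomog_pull_fst; exact: hd.
Qed.

(** The part of the model lying over [quintic_open]. *)
Definition model_open : pset P := fun y =>
  Y y /\ evalQ quintic_bad (tower_base (T := T) (pi y)) != 0.

Lemma model_open_open : open_in model_open Y.
Proof.
have [_ _ rpi _ _] := hpi; have [d hd] := tower_bad_homog.
exists (closure (fun y => Y y /\ evalQ tower_bad (pi y) = 0)).
  exact: closed_closure.
move=> y; split=> [[Yy ny]|[Yy ny]]; split=> //.
  move=> cl; have := regular_preimage rpi hd Yy cl.
  by rewrite tower_badE => /eqP; rewrite (negPf ny).
apply/eqP => y0; apply: ny; apply: sub_closure; last by rewrite tower_badE.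
have [[clY _] _ _ _ _] := hpi; exact: closed_is_point clY Yy.
Qed.

Lemma model_tower_isomorphic : isomorphic model_open
  (fun z => N3 z /\ evalQ quintic_bad (tower_base (T := T) z) != 0).
Proof.
have [_ _ [piN _] [psi inv] _] := hpi; have [d hd] := tower_bad_homog.
(* The small resolution is an isomorphism away from the Segre points. *)
have nS z : evalQ quintic_bad (tower_base (T := T) z) != 0 -> ~ N3_segre (T := T) z.
  by move=> /eqP z0 [_ /segre_quintic_bad].
exists pi, psi; apply: (mutually_inverse_sub inv).
- by move=> y [Yy ny]; split=> //; apply: nS.
- by move=> z [Nz nz]; split=> //; apply: nS.
- by move=> y [Yy ny]; split=> //; apply: piN.
move=> z [Nz nz]; case: (inv) => _ [NY _] _ idN.
have [Yz _] := NY z (conj Nz (nS z nz)); split=> //.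
have sz := idN z (conj Nz (nS z nz)).
by rewrite -tower_badE; apply: same_point_neq0 hd sz _; rewrite tower_badE.
Qed.

Lemma model_quintic_isomorphic : isomorphic quintic_open model_open.
Proof.
apply: isomorphic_trans (isomorphic_sym model_tower_isomorphic).
exact: N3_isomorphic T _ quintic_bad_coord_prod.
Qed.

Lemma model_open_dense : dense_in model_open Y.
Proof.
have [[clY irrY] _ _ _ _] := hpi.
apply: irreducible_open_dense clY irrY model_open_open _.
have [phi [_ [[AB _] _ _ _]]] := model_quintic_isomorphic.
by exists (phi sample_point); apply: AB; apply: sample_point_open.
Qed.

End Model.

Lemma square_open_open : open_in square_open S16_fibre_square.
Proof.
have [d hd] := square_bad_homog.
exists (fun z => is_point z /\ evalQ square_bad z = 0).
  exact: closed_zeros hd.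
move=> z; split=> [[Sz nz]|[Sz nz]]; split=> //.
  by case=> _ /eqP; rewrite (negPf nz).
by apply/eqP => z0; apply: nz; split=> //; case/S16_fibre_squareE: Sz.
Qed.

Theorem theorem5p1 (P : multiproj) (Y : pset P) (hY : barth_nieto_model Y) :
  birational S16_fibre_square Y.
Proof.
have [T [pi hpi]] := hY.
exists square_open, (model_open Y pi); split.
- exact: square_open_open.
- exact: square_open_dense.
- exact: model_open_open hpi.
- exact: model_open_dense hpi.
- exact: isomorphic_trans square_quintic_isomorphic
    (model_quintic_isomorphic hpi).
Qed.
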